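(* Let $\mathbf{k}$ be a commutative ring with unit. The functor $\mathtt{XU_d}\colon \mathbf{XLb}\to\mathbf{XDias}$ (universal enveloping crossed module), from the category of crossed modules of Leibniz $\mathbf{k}$-algebras to the category of crossed modules of $\mathbf{k}$-dialgebras, is left adjoint to the functor $\mathtt{XLb}\colon \mathbf{XDias}\to\mathbf{XLb}$.
   Context: All algebras are over a fixed commutative ring $\mathbf{k}$ with unit. **Dialgebras.** A dialgebra is a $\mathbf{k}$-module $D$ with two $\mathbf{k}$-bilinear products $\dashv,\vdash$ such that for all $x,y,z$: (1) $(x\dashv y)\dashv z=x\dashv(y\vdash z)$; (2) $(x\dashv y)\dashv z=x\dashv(y\dashv z)$; (3) $(x\vdash y)\dashv z=x\vdash(y\dashv z)$; (4) $(x\dashv y)\vdash z=x\vdash(y\vdash z)$; (5) $(x\vdash y)\vdash z=x\vdash(y\vdash z)$. Morphisms are linear maps preserving both products; the category is $\mathbf{Dias}$. An ideal is a submodule $I$ such that $x\dashv y,x\vdash y,y\dashv x,y\vdash x\in I$ for all $x\in I$, $y\in D$. An action of a dialgebra $D$ on a dialgebra $L$ consists of four bilinear maps $\dashv,\vdash\colon D\otimes L\to L$ and $\dashv,\vdash\colon L\otimes D\to L$ satisfying the 30 equalities obtained from (1)–(5) by taking one variable in $D$ and two in $L$ (15 equalities), or one variable in $L$ and two in $D$ (15 equalities). A crossed module of dialgebras is a dialgebra homomorphism $\mu\colon L\to D$ with an action of $D$ on $L$ such that, for $\star\in\{\dashv,\vdash\}$, $x\in D$, $l,l'\in L$: $\mu(x\star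 l)=x\star\mu(l)$, $\mu(l\star x)=\mu(l)\star x$, $\mu(l)\star l'=l\star l'=l\star\mu(l')$. A morphism $(L\xrightarrow{\mu}D)\to(L'\xrightarrow{\mu'}D')$ is a pair of dialgebra homomorphisms $\alpha\colon L\to L'$, $\beta\colon D\to D'$ with $\mu'\alpha=\beta\mu$, $\alpha(x\star l)=\beta(x)\star\alpha(l)$, $\alpha(l\star x)=\alpha(l)\star\beta(x)$. The category is $\mathbf{XDias}$. **Leibniz algebras.** A Leibniz algebra is a $\mathbf{k}$-module $\mathfrak g$ with a bilinear bracket satisfying $[x,[y,z]]=[[x,y],z]-[[x,z],y]$; the category is $\mathbf{Lb}$. A Leibniz action of $\mathfrak g$ on $\mathfrak q$ consists of bilinear maps $[\,,]\colon\mathfrak g\otimes\mathfrak q\to\mathfrak q$, $[\,,]\colon\mathfrak q\otimes\mathfrak g\to\mathfrak q$ satisfying the 6 equalities obtained from the Leibniz identity by taking one variable in $\mathfrak g$ and two in $\mathfrak q$, or one in $\mathfrak q$ and two in $\mathfrak g$. The semi-direct product $\mathfrak q\rtimes\mathfrak g$ is $\mathfrak q\oplus\mathfrak g$ with $[(q,g),(q',g')]=([q,q']+[q,g']+[g,q'],[g,g'])$. A Leibniz crossed module is a Leibniz homomorphism $\nu\colon\mathfrak q\to\mathfrak g$ with a Leibniz action of $\mathfrak g$ on $\mathfrak q$ such that $\nu[g,q]=[g,\nu(q)]$, $\nu[q,g]=[\nu(q),g]$, $[\nu(q),q']=[q,q']=[q,\nu(q')]$. A morphism $(\mathfrak q\xrightarrow{\nu}\mathfrak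 g)\to(\mathfrak q'\xrightarrow{\nu'}\mathfrak g')$ is a pair of Leibniz homomorphisms $\alpha\colon\mathfrak q\to\mathfrak q'$, $\beta\colon\mathfrak g\to\mathfrak g'$ with $\nu'\alpha=\beta\nu$, $\alpha[g,q]=[\beta(g),\alpha(q)]$, $\alpha[q,g]=[\alpha(q),\beta(g)]$. The category is $\mathbf{XLb}$. **Functors.** $\mathtt{Lb}\colon\mathbf{Dias}\to\mathbf{Lb}$ equips a dialgebra with the bracket $[x,y]=x\dashv y-y\vdash x$. $\mathtt{XLb}$ sends $(\mu\colon L\to D)$ to $\mathtt{Lb}(\mu)\colon\mathtt{Lb}(L)\to\mathtt{Lb}(D)$ with Leibniz action $[x,l]=x\dashv l-l\vdash x$, $[l,x]=l\dashv x-x\vdash l$ ($x\in D$, $l\in L$), and is the identity on underlying maps of morphisms. $\mathtt{U_d}\colon\mathbf{Lb}\to\mathbf{Dias}$ (universal enveloping dialgebra, left adjoint of $\mathtt{Lb}$) sends $\mathfrak g$ to the quotient of the free dialgebra on the $\mathbf{k}$-module $\mathfrak g$ by the ideal generated by all $[x,y]-x\dashv y+y\vdash x$, $x,y\in\mathfrak g$. For a Leibniz crossed module $\nu\colon\mathfrak q\to\mathfrak g$, let $s,t\colon\mathfrak q\rtimes\mathfrak g\to\mathfrak g$, $s(q,g)=g$, $t(q,g)=\nu(q)+g$. Let $X\subseteq\mathtt{U_d}(\mathfrak q\rtimes\mathfrak g)$ be $$X=\operatorname{Ker}\mathtt{U_d}(s)\dashv\operatorname{Ker}\mathtt{U_d}(t)+\operatorname{Ker}\mathtt{U_d}(t)\dashv\operatorname{Ker}\mathtt{U_d}(s)+\operatorname{Ker}\mathtt{U_d}(s)\vdash\operatorname{Ker}\mathtt{U_d}(t)+\operatorname{Ker}\mathtt{U_d}(t)\vdash\operatorname{Ker}\mathtt{U_d}(s)$$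 (each term is the $\mathbf{k}$-span of the products). Let $\overline{\mathtt{U_d}}(s),\overline{\mathtt{U_d}}(t)\colon\mathtt{U_d}(\mathfrak q\rtimes\mathfrak g)/X\to\mathtt{U_d}(\mathfrak g)$ be the induced homomorphisms. $\mathtt{U_d}(\mathfrak g)$ is regarded as a subdialgebra of $\mathtt{U_d}(\mathfrak q\rtimes\mathfrak g)/X$ via the map induced by $g\mapsto(0,g)$. Then $\mathtt{XU_d}(\mathfrak q\xrightarrow{\nu}\mathfrak g)$ is the crossed module of dialgebras $$\overline{\mathtt{U_d}}(t)|_{\operatorname{Ker}\overline{\mathtt{U_d}}(s)}\colon\operatorname{Ker}\overline{\mathtt{U_d}}(s)\to\mathtt{U_d}(\mathfrak g),$$ with $\mathtt{U_d}(\mathfrak g)$ acting on $\operatorname{Ker}\overline{\mathtt{U_d}}(s)$ by the products of $\mathtt{U_d}(\mathfrak q\rtimes\mathfrak g)/X$. On a morphism $(\alpha,\beta)$, $\mathtt{XU_d}$ is induced by $\mathtt{U_d}(\alpha\times\beta)$ and $\mathtt{U_d}(\beta)$. *)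

(* Defs.v *)
From HB Require Import structures.
From mathcomp Require Import all_boot all_algebra ssrAC.
From mathcomp Require Import boolp classical_sets.

Set Implicit Arguments.
Unset Strict Implicit.
Unset Printing Implicit Defensive.

Import GRing.Theory.
Local Open Scope ring_scope.
Local Open Scope classical_set_scope.

Record category := Category {
  ob :> Type;
  hom : ob -> ob -> Type;
  idm : forall a, hom a a;
  comp : forall a b c, hom b c -> hom a b -> hom a c;
  compA : forall a b c d (h : hom c d) (g : hom b c) (f : hom a b),
    comp h (comp g f) = comp (comp h g) f;
  comp1m : forall a b (f : hom a b), comp (idm b) f = f;
  compm1 : forall a b (f : hom a b), comp f (idm a) = f
}.

Record functor (C D : category) := Functor {
  fob :> C -> D;
  fmap : forall a b, hom a b -> hom (fob a) (fob b);
  fmap_id : forall a, fmap (idm a) = idm (fob a);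
  fmap_comp : forall a b c (g : hom b c) (f : hom a b),
    fmap (comp g f) = comp (fmap g) (fmap f)
}.

Definition left_adjoint (C D : category) (F : functor C D) (G : functor D C) :=
  exists phi : forall (c : C) (d : D), hom (F c) d -> hom c (G d),
    (forall c d, bijective (phi c d)) /\
    (forall (c c' : C) (d d' : D) (f : hom c' c) (g : hom d d')
            (h : hom (F c) d),
       phi c' d' (comp g (comp h (fmap F f)))
       = comp (fmap G g) (comp (phi c d h) f)).

Section Linear.
Variable k : comPzRingType.
Implicit Types U V W : lmodType k.

(* The [bilinear] of sesquilinear.v is only available over nontrivial rings. *)
Definition bilin U V W (f : U -> V -> W) :=
  (forall u, linear (f u)) /\ (forall v, linear (f^~ v)).

Definition mklin U V (f : U -> V) (fP : linear f) : {linear U -> V} :=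
  HB.pack f (GRing.isLinear.Build k U V _ f fP).

Lemma linear_ext U V (f g : {linear U -> V}) : f =1 g -> f = g.
Proof.
case: f g => [f cf] [g cg] /= /funext fg.
move: cf cg; rewrite fg => cf cg; congr GRing.Linear.Pack.
move: cf cg => [[a1] [a2]] [[b1] [b2]].
by rewrite (Prop_irrelevance a1 b1) (Prop_irrelevance a2 b2).
Qed.

Lemma bilinDl U V W (f : U -> V -> W) : bilin f ->
  forall u u' v, f (u + u') v = f u v + f u' v.
Proof. by case=> _ H u u' v; have := H v 1 u u'; rewrite !scale1r. Qed.
Lemma bilinDr U V W (f : U -> V -> W) : bilin f ->
  forall u v v', f u (v + v') = f u v + f u v'.
Proof. by case=> H _ u v v'; have := H u 1 v v'; rewrite !scale1r. Qed.
Lemma bilin0l U V W (f : U -> V -> W) : bilin f -> forall v, f 0 v = 0.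
Proof. by case=> _ H v; have := linear0 (mklin (H v)). Qed.
Lemma bilin0r U V W (f : U -> V -> W) : bilin f -> forall u, f u 0 = 0.
Proof. by case=> H _ u; have := linear0 (mklin (H u)). Qed.
Lemma bilinZl U V W (f : U -> V -> W) : bilin f ->
  forall a u v, f (a *: u) v = a *: f u v.
Proof. by case=> _ H a u v; exact: (linearZZ (mklin (H v))). Qed.
Lemma bilinZr U V W (f : U -> V -> W) : bilin f ->
  forall a u v, f u (a *: v) = a *: f u v.
Proof. by case=> H _ a u v; exact: (linearZZ (mklin (H u))). Qed.
Lemma bilinBl U V W (f : U -> V -> W) : bilin f ->
  forall u u' v, f (u - u') v = f u v - f u' v.
Proof. by case=> _ H u u' v; have := linearB (mklin (H v)) u u'. Qed.
Lemma bilinBr U V W (f : U -> V -> W) : bilin f ->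
  forall u v v', f u (v - v') = f u v - f u v'.
Proof. by case=> H _ u v v'; have := linearB (mklin (H u)) v v'. Qed.

Definition submodule V (M : set V) :=
  M 0 /\ forall (a : k) x y, M x -> M y -> M (a *: x + y).

Definition span V (S : set V) : set V :=
  [set x | forall M : set V, submodule M -> S `<=` M -> M x].

Definition addset V (A B : set V) : set V := [set a + b | a in A & b in B].

Lemma submoduleD V (M : set V) : submodule M ->
  forall x y, M x -> M y -> M (x + y).
Proof. by case=> _ MD x y Mx My; rewrite -[x]scale1r; exact: MD. Qed.
Lemma submoduleB V (M : set V) : submodule M ->
  forall x y, M x -> M y -> M (x - y).
Proof. by case=> _ MD x y Mx My; rewrite addrC -scaleN1r; exact: MD. Qed.
Lemma submoduleZ V (M : set V) : submodule M ->
  forall a x, M x -> M (a *: x).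
Proof. by case=> M0 MD a x Mx; rewrite -[_ *: _]addr0; exact: MD. Qed.

Lemma span_submodule V (S : set V) : submodule (span S).
Proof.
split=> [M [] // | a x y Sx Sy M MM SM].
by apply: MM.2; [exact: Sx | exact: Sy].
Qed.
Lemma sub_span V (S : set V) : S `<=` span S.
Proof. by move=> x Sx M _; apply. Qed.

Lemma addset_submodule V (A B : set V) :
  submodule A -> submodule B -> submodule (addset A B).
Proof.
move=> [A0 AD] [B0 BD]; split; first by exists 0 => //; exists 0; rewrite ?addr0.
move=> a _ _ [x Ax [y By <-]] [z Az [t Bt <-]].
exists (a *: x + z); first exact: AD.
by exists (a *: y + t); [exact: BD | rewrite scalerDr addrACA].
Qed.

Lemma ker_submodule V W (f : {linear V -> W}) :
  submodule [set x | f x = 0].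
Proof.
split=> [|a x y /= fx fy]; first exact: linear0.
by rewrite linearP fx fy scaler0 addr0.
Qed.

End Linear.

Section QuotMod.
Variables (k : comPzRingType) (V : lmodType k) (M : set V).
Hypothesis MM : submodule M.

(* The proof argument only serves to key the canonical structures. *)
Definition qpred (_ : submodule M) : pred V := fun x => `[< M x >].

Let qpred_closed : zmod_closed (qpred MM).
Proof.
split; first by apply/asboolP; exact: MM.1.
by move=> x y /asboolP Mx /asboolP My; apply/asboolP; exact: submoduleB.
Qed.
HB.instance Definition _ := GRing.isZmodClosed.Build V (qpred MM) qpred_closed.

Definition quotmod := Quotient.quot (GRing.ZmodClosed.clone V (qpred MM) _).
HB.instance Definition _ := GRing.Zmodule.on quotmod.

Definition qpi (x : V) : quotmod := \pi_(Quotient.quot (GRing.ZmodClosed.clone V (qpred MM) _))%qT x.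

Lemma qpi_eq x y : qpi x = qpi y <-> M (x - y).
Proof.
rewrite /qpi; split => [/eqP|Mxy].
  by rewrite -Quotient.idealrBE => /asboolP.
by apply/eqP; rewrite -Quotient.idealrBE; apply/asboolP.
Qed.

Definition qrepr (x : quotmod) : V := repr (x : Quotient.quot (GRing.ZmodClosed.clone V (qpred MM) _)).
Lemma qreprK : cancel qrepr qpi. Proof. exact: reprK. Qed.
Lemma qpiD x y : qpi (x + y) = qpi x + qpi y.
Proof. by rewrite /qpi raddfD. Qed.
Lemma qrepr_qpi x : M (qrepr (qpi x) - x).
Proof. by apply/qpi_eq; rewrite qreprK. Qed.

Definition qscale (a : k) (x : quotmod) : quotmod := qpi (a *: qrepr x).
Lemma qscale_pi a x : qscale a (qpi x) = qpi (a *: x).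
Proof.
by apply/qpi_eq; rewrite -scalerBr; apply: submoduleZ => //; exact: qrepr_qpi.
Qed.
Lemma qind (P : quotmod -> Prop) : (forall x, P (qpi x)) -> forall x, P x.
Proof. by move=> H x; rewrite -[x]qreprK. Qed.

Let qscaleA a b v : qscale a (qscale b v) = qscale (a * b) v.
Proof. by elim/qind: v => v; rewrite !qscale_pi scalerA. Qed.
Let qscale1 : left_id 1 qscale.
Proof. by elim/qind => v; rewrite qscale_pi scale1r. Qed.
Let qscaleDr : right_distributive qscale +%R.
Proof.
move=> a; elim/qind => u; elim/qind => v.
by rewrite -qpiD !qscale_pi scalerDr qpiD.
Qed.
Let qscaleDl v : {morph qscale^~ v : a b / a + b}.
Proof. by elim/qind: v => v a b; rewrite !qscale_pi scalerDl qpiD. Qed.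
HB.instance Definition _ := GRing.Zmodule_isLmodule.Build k quotmod
  qscaleA qscale1 qscaleDr qscaleDl.

Lemma qpi_is_linear : linear qpi.
Proof. by move=> a x y; rewrite qpiD -qscale_pi. Qed.

End QuotMod.

Section Biprod.
Variable k : comPzRingType.

Record biprod (X Y Z : lmodType k) := Biprod {
  lprod : X -> Y -> Z;
  rprod : X -> Y -> Z;
  lprod_bilin : bilin lprod;
  rprod_bilin : bilin rprod
}.

End Biprod.

Notation "x ⊣[ p ] y" := (lprod p x y) (at level 40, p at level 200).
Notation "x ⊢[ p ] y" := (rprod p x y) (at level 40, p at level 200).

Section DialgebraDef.
Variable k : comPzRingType.

(* The five dialgebra identities for x in X, y in Y, z in Z, where the pairs of
   products p : X x Y -> A, q : Y x Z -> B, p' : A x Z -> W and q' : X x B -> W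
   may differ, so that the same definition also yields the identities of
   actions. *)
Definition dias_eqs (X Y Z A B W : lmodType k) (p : biprod X Y A)
    (q : biprod Y Z B) (p' : biprod A Z W) (q' : biprod X B W) :=
  forall x y z,
  [/\ (x ⊣[p] y) ⊣[p'] z = x ⊣[q'] (y ⊢[q] z),
      (x ⊣[p] y) ⊣[p'] z = x ⊣[q'] (y ⊣[q] z),
      (x ⊢[p] y) ⊣[p'] z = x ⊢[q'] (y ⊣[q] z),
      (x ⊣[p] y) ⊢[p'] z = x ⊢[q'] (y ⊢[q] z)
    & (x ⊢[p] y) ⊢[p'] z = x ⊢[q'] (y ⊢[q] z)].

Record dialgebra := Dialgebra {
  dcar :> lmodType k;
  dprod : biprod dcar dcar dcar;
  dprod_eqs : dias_eqs dprod dprod dprod dprod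
}.

End DialgebraDef.

Notation "x ⊣ y" := (x ⊣[dprod _] y) (at level 40).
Notation "x ⊢ y" := (x ⊢[dprod _] y) (at level 40).

Section Dialgebra.
Variable k : comPzRingType.
Local Notation dialgebra := (dialgebra k).

Record dias_hom (D E : dialgebra) := DiasHom {
  dhom_lin :> {linear D -> E};
  dhom_l : forall x y, dhom_lin (x ⊣ y) = dhom_lin x ⊣ dhom_lin y;
  dhom_r : forall x y, dhom_lin (x ⊢ y) = dhom_lin x ⊢ dhom_lin y
}.

Lemma dias_hom_ext D E (f g : dias_hom D E) : f =1 g -> f = g.
Proof.
case: f g => [f fl fr] [g gl gr] /= /linear_ext fg.
by move: fl fr gl gr; rewrite fg => *; congr DiasHom; exact: Prop_irrelevance.
Qed.

Definition dias_id D : dias_hom D D.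
Proof. by exists (mklin (f := id) (fun _ _ _ => erefl)). Defined.

Definition dias_comp D E F (g : dias_hom E F) (f : dias_hom D E) :
  dias_hom D F.
Proof.
exists (mklin (f := g \o f) (linearP (g \o f))) => x y /=.
  by rewrite !dhom_l.
by rewrite !dhom_r.
Defined.

Definition dias_ideal (D : dialgebra) (I : set D) :=
  submodule I /\
  forall x y, I x -> [/\ I (x ⊣ y), I (x ⊢ y), I (y ⊣ x) & I (y ⊢ x)].

Definition ideal_gen (D : dialgebra) (S : set D) : set D :=
  [set x | forall I : set D, dias_ideal I -> S `<=` I -> I x].

Definition dker D E (f : dias_hom D E) : set D := [set x | f x = 0].

(* In act_XYZ, the letters give the algebras of the three variables x, y, z. *)
Record dias_action (D L : dialgebra) := DiasAction {
  lact : biprod D L L;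
  ract : biprod L D L;
  act_DLL : dias_eqs lact (dprod L) (dprod L) lact;
  act_LDL : dias_eqs ract lact (dprod L) (dprod L);
  act_LLD : dias_eqs (dprod L) ract ract (dprod L);
  act_LDD : dias_eqs ract (dprod D) ract ract;
  act_DLD : dias_eqs lact ract ract lact;
  act_DDL : dias_eqs (dprod D) lact lact lact
}.

Record xdias := XDias {
  xd_L : dialgebra;
  xd_D : dialgebra;
  xd_mu : dias_hom xd_L xd_D;
  xd_act : dias_action xd_D xd_L;
  xd_mu_lact : forall x l,
    xd_mu (x ⊣[lact xd_act] l) = x ⊣ xd_mu l /\
    xd_mu (x ⊢[lact xd_act] l) = x ⊢ xd_mu l;
  xd_mu_ract : forall l x,
    xd_mu (l ⊣[ract xd_act] x) = xd_mu l ⊣ x /\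
    xd_mu (l ⊢[ract xd_act] x) = xd_mu l ⊢ x;
  xd_peiffer_l : forall l l',
    xd_mu l ⊣[lact xd_act] l' = l ⊣ l' /\
    xd_mu l ⊢[lact xd_act] l' = l ⊢ l';
  xd_peiffer_r : forall l l',
    l ⊣[ract xd_act] xd_mu l' = l ⊣ l' /\
    l ⊢[ract xd_act] xd_mu l' = l ⊢ l'
}.

Record xdias_hom (A B : xdias) := XDiasHom {
  xdh_L : dias_hom (xd_L A) (xd_L B);
  xdh_D : dias_hom (xd_D A) (xd_D B);
  xdh_mu : forall l, xd_mu B (xdh_L l) = xdh_D (xd_mu A l);
  xdh_lact : forall x l,
    xdh_L (x ⊣[lact (xd_act A)] l) = xdh_D x ⊣[lact (xd_act B)] xdh_L l /\
    xdh_L (x ⊢[lact (xd_act A)] l) = xdh_D x ⊢[lact (xd_act B)] xdh_L l;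
  xdh_ract : forall l x,
    xdh_L (l ⊣[ract (xd_act A)] x) = xdh_L l ⊣[ract (xd_act B)] xdh_D x /\
    xdh_L (l ⊢[ract (xd_act A)] x) = xdh_L l ⊢[ract (xd_act B)] xdh_D x
}.

Lemma xdias_hom_ext A B (f g : xdias_hom A B) :
  xdh_L f =1 xdh_L g -> xdh_D f =1 xdh_D g -> f = g.
Proof.
case: f g => [f1 f2 a b c] [g1 g2 a' b' c'] /= /dias_hom_ext e1 /dias_hom_ext e2.
move: a b c a' b' c'; rewrite e1 e2 => *.
by congr XDiasHom; exact: Prop_irrelevance.
Qed.

Definition xdias_id A : xdias_hom A A.
Proof. by exists (dias_id _) (dias_id _). Defined.

Definition xdias_comp A B C (g : xdias_hom B C) (f : xdias_hom A B) :
  xdias_hom A C.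
Proof.
exists (dias_comp (xdh_L g) (xdh_L f)) (dias_comp (xdh_D g) (xdh_D f)).
- by move=> l /=; rewrite !xdh_mu.
- by move=> x l /=; rewrite !(xdh_lact _ _ _).1 !(xdh_lact _ _ _).2.
- by move=> l x /=; rewrite !(xdh_ract _ _ _).1 !(xdh_ract _ _ _).2.
Defined.

Definition XDias_cat : category.
Proof.
exists xdias xdias_hom xdias_id xdias_comp;
  by move=> *; apply: xdias_hom_ext.
Defined.

Section Quot.
Variables (D : dialgebra) (I : set D).
Hypothesis II : dias_ideal I.

Let Q : lmodType k := quotmod II.1.
Let pi : D -> Q := @qpi k D I II.1.
Let rp : Q -> D := @qrepr k D I II.1.

Lemma quot_op_pi (f : D -> D -> D) : bilin f ->
  (forall x y, I x -> I (f x y) /\ I (f y x)) ->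
  forall x y, pi (f (rp (pi x)) (rp (pi y))) = pi (f x y).
Proof.
move=> bf If x y; apply/qpi_eq.
rewrite -[X in X - _](subrK (f x (rp (pi y)))) -addrA.
rewrite -(bilinBl bf) -(bilinBr bf).
have Ix := qrepr_qpi II.1 x; have Iy := qrepr_qpi II.1 y.
by apply: (submoduleD II.1); [exact: (If _ _ Ix).1 | exact: (If _ _ Iy).2].
Qed.

Lemma quot_op_bilin (f : D -> D -> D) : bilin f ->
  (forall x y, I x -> I (f x y) /\ I (f y x)) ->
  bilin (fun x y : Q => pi (f (rp x) (rp y))).
Proof.
move=> bf If; have E := quot_op_pi bf If.
have L := @qpi_is_linear k D I II.1.
split; elim/qind => u a; elim/qind => v; elim/qind => w; rewrite -L !E -L;
  by congr pi; case: bf => h1 h2; rewrite ?h1 ?h2.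
Qed.

Let clos_l x y : I x -> I (x ⊣ y) /\ I (y ⊣ x).
Proof. by move=> Ix; case: (II.2 x y Ix). Qed.
Let clos_r x y : I x -> I (x ⊢ y) /\ I (y ⊢ x).
Proof. by move=> Ix; case: (II.2 x y Ix). Qed.

Definition quot_prod : biprod Q Q Q :=
  Biprod (quot_op_bilin (lprod_bilin (dprod D)) clos_l)
         (quot_op_bilin (rprod_bilin (dprod D)) clos_r).

Lemma quot_l x y : pi x ⊣[quot_prod] pi y = pi (x ⊣ y).
Proof. exact: (quot_op_pi (lprod_bilin (dprod D)) clos_l). Qed.
Lemma quot_r x y : pi x ⊢[quot_prod] pi y = pi (x ⊢ y).
Proof. exact: (quot_op_pi (rprod_bilin (dprod D)) clos_r). Qed.

Lemma quot_eqs : dias_eqs quot_prod quot_prod quot_prod quot_prod.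
Proof.
elim/qind => x; elim/qind => y; elim/qind => z.
rewrite -!/(pi _) !(quot_l x y, quot_r x y, quot_l y z, quot_r y z).
rewrite !(quot_l _ z, quot_r _ z, quot_l x, quot_r x).
case: (dprod_eqs x y z) => e1 e2 e3 e4 e5.
by split; congr pi.
Qed.

Definition quot_dias : dialgebra := Dialgebra quot_eqs.

Definition quot_pi : dias_hom D quot_dias.
Proof.
exists (mklin (@qpi_is_linear k D I II.1)) => x y /=.
  exact/esym/quot_l.
exact/esym/quot_r.
Defined.

Lemma quot_pi_ind (P : quot_dias -> Prop) :
  (forall x, P (quot_pi x)) -> forall x, P x.
Proof. exact: qind. Qed.

Lemma quot_pi_eq0 x : quot_pi x = 0 <-> I x.
Proof. by rewrite -[0](linear0 quot_pi) qpi_eq subr0. Qed.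

Lemma quot_hom_ext E (f g : dias_hom quot_dias E) :
  (forall x, f (quot_pi x) = g (quot_pi x)) -> f = g.
Proof. by move=> H; apply: dias_hom_ext; elim/quot_pi_ind. Qed.

Variables (E : dialgebra) (f : dias_hom D E).
Hypothesis fI : I `<=` dker f.

Definition quot_lift_fun (x : quot_dias) : E := f (rp x).

Lemma quot_lift_pi x : quot_lift_fun (quot_pi x) = f x.
Proof.
by apply/eqP; rewrite -subr_eq0 -linearB; apply/eqP/fI; exact: qrepr_qpi.
Qed.

Lemma quot_lift_linear : linear quot_lift_fun.
Proof.
move=> a; elim/quot_pi_ind => x; elim/quot_pi_ind => y.
by rewrite -linearP !quot_lift_pi linearP.
Qed.

Definition quot_lift : dias_hom quot_dias E.
Proof.
exists (mklin quot_lift_linear); elim/quot_pi_ind => x; elim/quot_pi_ind => y.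
  change (quot_lift_fun (quot_pi x ⊣ quot_pi y)
          = quot_lift_fun (quot_pi x) ⊣ quot_lift_fun (quot_pi y)).
  by rewrite -(dhom_l quot_pi) !quot_lift_pi dhom_l.
change (quot_lift_fun (quot_pi x ⊢ quot_pi y)
        = quot_lift_fun (quot_pi x) ⊢ quot_lift_fun (quot_pi y)).
by rewrite -(dhom_r quot_pi) !quot_lift_pi dhom_r.
Defined.

Lemma quot_liftE x : quot_lift (quot_pi x) = f x.
Proof. exact: (quot_lift_pi x). Qed.

End Quot.

Lemma ideal_gen_ideal (D : dialgebra) (S : set D) : dias_ideal (ideal_gen S).
Proof.
split; [split|].
- by move=> I [[]].
- by move=> a x y Sx Sy I II SI; apply: II.1.2; [exact: Sx | exact: Sy].
- move=> x y Sx; split=> I II SI; by case: (II.2 x y (Sx I II SI)).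
Qed.

Lemma dker_ideal D E (f : dias_hom D E) : dias_ideal (dker f).
Proof.
split; first exact: ker_submodule.
move=> x y fx; rewrite /dker /= !(dhom_l, dhom_r) fx.
by split; rewrite ?(bilin0l (lprod_bilin _)) ?(bilin0l (rprod_bilin _))
  ?(bilin0r (lprod_bilin _)) ?(bilin0r (rprod_bilin _)).
Qed.

Section Ker.
Variables (E F : dialgebra) (s : dias_hom E F).

Definition kpred : pred E := fun x => s x == 0.
Let kpred_closed : submod_closed kpred.
Proof.
have [k0 kD] := ker_submodule s.
split; first by apply/eqP.
by move=> a x y /eqP sx /eqP sy; apply/eqP; exact: kD.
Qed.
HB.instance Definition _ := GRing.isSubmodClosed.Build k E kpred kpred_closed.

Record kerT := KerT { kval : E; kvalP : kval \in kpred }.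
HB.instance Definition _ := [isSub for kval].
HB.instance Definition _ := [Choice of kerT by <:].
HB.instance Definition _ := [SubChoice_isSubLmodule of kerT by <:].

Lemma kval_eq0 (x : kerT) : s (kval x) = 0. Proof. exact/eqP/kvalP. Qed.
Definition mkker (x : E) (sx : s x = 0) : kerT := KerT (introT eqP sx).
Lemma kval_linear (a : k) (x y : kerT) :
  kval (a *: x + y) = a *: kval x + kval y.
Proof. exact: (linearP (val : kerT -> E)). Qed.
Lemma ker_inj : injective kval. Proof. exact: val_inj. Qed.

Let kerM (l : E) (sl : s l = 0) (x : E) :
  [/\ s (l ⊣ x) = 0, s (l ⊢ x) = 0, s (x ⊣ l) = 0 & s (x ⊢ l) = 0].
Proof. by have [_ /(_ _ x sl)] := dker_ideal s. Qed.

Lemma ker_s_ll l x : s l = 0 -> s (l ⊣ x) = 0. Proof. by case/kerM/(_ x). Qed.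
Lemma ker_s_lr l x : s l = 0 -> s (l ⊢ x) = 0. Proof. by case/kerM/(_ x). Qed.
Lemma ker_s_rl l x : s l = 0 -> s (x ⊣ l) = 0. Proof. by case/kerM/(_ x). Qed.
Lemma ker_s_rr l x : s l = 0 -> s (x ⊢ l) = 0. Proof. by case/kerM/(_ x). Qed.

Definition ker_prod : biprod kerT kerT kerT.
Proof.
exists (fun x y => mkker (ker_s_ll (kval y) (kval_eq0 x)))
       (fun x y => mkker (ker_s_lr (kval y) (kval_eq0 x)));
  split=> u a v w; apply: ker_inj; rewrite [RHS]kval_linear /= ?kval_linear.
- exact: (lprod_bilin _).1.
- exact: (lprod_bilin _).2.
- exact: (rprod_bilin _).1.
- exact: (rprod_bilin _).2.
Defined.

Definition ker_dias : dialgebra.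
Proof.
exists kerT ker_prod => x y z; case: (dprod_eqs (kval x) (kval y) (kval z)).
by split; exact: ker_inj.
Defined.

Variables (D : dialgebra) (i : dias_hom D E).

Definition ker_lact : biprod D ker_dias ker_dias.
Proof.
exists (fun x l => mkker (ker_s_rl (i x) (kval_eq0 l)))
       (fun x l => mkker (ker_s_rr (i x) (kval_eq0 l)));
  split=> u a v w; apply: ker_inj; rewrite [RHS]kval_linear /= ?kval_linear ?linearP.
- exact: (lprod_bilin _).1.
- exact: (lprod_bilin _).2.
- exact: (rprod_bilin _).1.
- exact: (rprod_bilin _).2.
Defined.

Definition ker_ract : biprod ker_dias D ker_dias.
Proof.
exists (fun l x => mkker (ker_s_ll (i x) (kval_eq0 l)))
       (fun l x => mkker (ker_s_lr (i x) (kval_eq0 l)));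
  split=> u a v w; apply: ker_inj; rewrite [RHS]kval_linear /= ?kval_linear ?linearP.
- exact: (lprod_bilin _).1.
- exact: (lprod_bilin _).2.
- exact: (rprod_bilin _).1.
- exact: (rprod_bilin _).2.
Defined.

Definition ker_action : dias_action D ker_dias.
Proof.
exists ker_lact ker_ract => x y z.
- case: (dprod_eqs (i x) (kval y) (kval z)); by split; exact: ker_inj.
- case: (dprod_eqs (kval x) (i y) (kval z)); by split; exact: ker_inj.
- case: (dprod_eqs (kval x) (kval y) (i z)); by split; exact: ker_inj.
- case: (dprod_eqs (kval x) (i y) (i z)).
  by split; apply: ker_inj; rewrite /= ?dhom_l ?dhom_r.
- case: (dprod_eqs (i x) (kval y) (i z)); by split; exact: ker_inj.
- case: (dprod_eqs (i x) (i y) (kval z)).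
  by split; apply: ker_inj; rewrite /= ?dhom_l ?dhom_r.
Defined.

Definition ker_incl : dias_hom ker_dias E.
Proof. by exists (mklin kval_linear). Defined.

End Ker.

Definition lspan (D : dialgebra) (A B : set D) : set D :=
  span [set a ⊣ b | a in A & b in B].
Definition rspan (D : dialgebra) (A B : set D) : set D :=
  span [set a ⊢ b | a in A & b in B].

Definition xset (E F : dialgebra) (s t : dias_hom E F) : set E :=
  addset (addset (addset (lspan (dker s) (dker t)) (lspan (dker t) (dker s)))
                 (rspan (dker s) (dker t)))
         (rspan (dker t) (dker s)).

Definition stable_in (D : dialgebra) (T S : set D) :=
  forall x y, S x -> [/\ T (x ⊣ y), T (x ⊢ y), T (y ⊣ x) & T (y ⊢ x)].

Lemma addset_stable (D : dialgebra) (T A B : set D) : submodule T ->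
  stable_in T A -> stable_in T B -> stable_in T (addset A B).
Proof.
move=> /submoduleD TD A2 B2 _ y [a Aa [b Bb <-]].
have [a1 a2 a3 a4] := A2 a y Aa; have [b1 b2 b3 b4] := B2 b y Bb.
rewrite (bilinDl (lprod_bilin _)) (bilinDl (rprod_bilin _)).
rewrite (bilinDr (lprod_bilin _)) (bilinDr (rprod_bilin _)).
by split; exact: TD.
Qed.

Lemma span_stable (D : dialgebra) (T S : set D) : submodule T ->
  stable_in T S -> stable_in T (span S).
Proof.
move=> Tm ST x y Sx; have [T0 TD] := Tm.
apply: (Sx [set x | [/\ T (x ⊣ y), T (x ⊢ y), T (y ⊣ x) & T (y ⊢ x)]]).
  split=> /=.
    by rewrite (bilin0l (lprod_bilin _)) (bilin0l (rprod_bilin _))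
      (bilin0r (lprod_bilin _)) (bilin0r (rprod_bilin _)).
  move=> a u v [u1 u2 u3 u4] [v1 v2 v3 v4].
  rewrite (bilinDl (lprod_bilin _)) (bilinDl (rprod_bilin _))
    (bilinDr (lprod_bilin _)) (bilinDr (rprod_bilin _)).
  rewrite (bilinZl (lprod_bilin _)) (bilinZl (rprod_bilin _))
    (bilinZr (lprod_bilin _)) (bilinZr (rprod_bilin _)).
  by split; exact: TD.
by move=> u Su; exact: ST.
Qed.

Lemma prod_stable (D : dialgebra) (T A B : set D) :
  dias_ideal A -> dias_ideal B ->
  lspan A B `<=` T -> rspan A B `<=` T ->
  stable_in T [set a ⊣ b | a in A & b in B] /\
  stable_in T [set a ⊢ b | a in A & b in B].
Proof.
move=> [_ A2] [_ B2] TL TR.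
have L a b : A a -> B b -> T (a ⊣ b).
  by move=> Aa Bb; apply: TL; apply: sub_span; exists a => //; exists b.
have R a b : A a -> B b -> T (a ⊢ b).
  by move=> Aa Bb; apply: TR; apply: sub_span; exists a => //; exists b.
split=> _ y [a Aa [b Bb <-]];
  have [a1 a2 a3 a4] := A2 a y Aa; have [b1 b2 b3 b4] := B2 b y Bb;
  have [e1 e2 e3 e4 e5] := dprod_eqs a b y;
  have [f1 f2 f3 f4 f5] := dprod_eqs y a b.
- by rewrite e2 e4 -f2 -f3; split; [apply: L | apply: R | apply: L | apply: L].
- by rewrite e3 e5 -f1 -f5; split; [apply: R | apply: R | apply: L | apply: R].
Qed.

Lemma addset_subl (V : lmodType k) (A B : set V) : submodule B ->
  A `<=` addset A B.
Proof. by move=> [B0 _] x Ax; exists x => //; exists 0; rewrite ?addr0. Qed.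
Lemma addset_subr (V : lmodType k) (A B : set V) : submodule A ->
  B `<=` addset A B.
Proof. by move=> [A0 _] x Bx; exists 0 => //; exists x; rewrite ?add0r. Qed.

Section XSet.
Variables (E F : dialgebra) (s t : dias_hom E F).

Let S (U : set E) : submodule (span U) := span_submodule U.
Let M1 := addset_submodule (S [set a ⊣ b | a in dker s & b in dker t])
                           (S [set a ⊣ b | a in dker t & b in dker s]).
Let M2 := addset_submodule M1 (S [set a ⊢ b | a in dker s & b in dker t]).
Let M3 := addset_submodule M2 (S [set a ⊢ b | a in dker t & b in dker s]).

Lemma xset_st_l : lspan (dker s) (dker t) `<=` xset s t.
Proof. by do !(apply: subset_trans (addset_subl (S _)) => //). Qed.
Lemma xset_ts_l : lspan (dker t) (dker s) `<=` xset s t.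
Proof.
move=> x Ux; apply/(addset_subl (S _))/(addset_subl (S _)).
exact/(addset_subr (S _)).
Qed.
Lemma xset_st_r : rspan (dker s) (dker t) `<=` xset s t.
Proof. by move=> x Ux; apply/(addset_subl (S _))/(addset_subr M1). Qed.
Lemma xset_ts_r : rspan (dker t) (dker s) `<=` xset s t.
Proof. by move=> x Ux; apply/(addset_subr M2). Qed.

Lemma xset_ideal : dias_ideal (xset s t).
Proof.
have [Is It] := (dker_ideal s, dker_ideal t).
have [P1 P2] := prod_stable Is It xset_st_l xset_st_r.
have [P3 P4] := prod_stable It Is xset_ts_l xset_ts_r.
split=> //.
by do ![apply: addset_stable => //]; exact: span_stable.
Qed.

Lemma xset_prod a b : dker s a -> dker t b ->
  [/\ xset s t (a ⊣ b), xset s t (b ⊣ a), xset s t (a ⊢ b)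
    & xset s t (b ⊢ a)].
Proof.
move=> sa tb; split.
- by apply: xset_st_l; apply: sub_span; exists a => //; exists b.
- by apply: xset_ts_l; apply: sub_span; exists b => //; exists a.
- by apply: xset_st_r; apply: sub_span; exists a => //; exists b.
- by apply: xset_ts_r; apply: sub_span; exists b => //; exists a.
Qed.

Lemma xset_sub (G : dialgebra) (h : dias_hom E G) :
  (forall a b, dker s a -> dker t b ->
    [/\ h (a ⊣ b) = 0, h (b ⊣ a) = 0, h (a ⊢ b) = 0 & h (b ⊢ a) = 0]) ->
  xset s t `<=` dker h.
Proof.
move=> H; have [K _] := dker_ideal h.
move=> _ [_ [_ [u U [v V <-]] [w W <-]] [x X <-]].
apply: (submoduleD K); first apply: (submoduleD K); first apply: (submoduleD K).
- by apply: U => // _ [a sa [b tb <-]]; case: (H a b).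
- by apply: V => // _ [a ta [b sb <-]]; case: (H b a).
- by apply: W => // _ [a sa [b tb <-]]; case: (H a b).
- by apply: X => // _ [a ta [b sb <-]]; case: (H b a).
Qed.

Lemma xset_sub_s : xset s t `<=` dker s.
Proof.
apply: xset_sub => a b sa _; have [_ /(_ a b sa)] := dker_ideal s.
by case.
Qed.

Lemma xset_sub_t : xset s t `<=` dker t.
Proof.
apply: xset_sub => a b _ tb; have [_ /(_ b a tb)] := dker_ideal t.
by case.
Qed.

End XSet.

(* The free dialgebra on a module is realized as the type of formal
   expressions modulo the congruence generated by the module axioms, the
   linearity of the generators, the bilinearity of the products and the
   dialgebra identities; its universal property is given by free_lift,
   free_lift_gen and free_hom_ext. *)

Section Free.
Variable V : lmodType k.

Inductive dterm :=
  | TGen of V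
  | TZero
  | TOpp of dterm
  | TAdd of dterm & dterm
  | TScale of k & dterm
  | TL of dterm & dterm
  | TR of dterm & dterm.

Inductive dcong : dterm -> dterm -> Prop :=
  | cong_refl x : dcong x x
  | cong_sym x y : dcong x y -> dcong y x
  | cong_trans x y z : dcong x y -> dcong y z -> dcong x z
  | cong_opp x x' : dcong x x' -> dcong (TOpp x) (TOpp x')
  | cong_add x x' y y' :
      dcong x x' -> dcong y y' -> dcong (TAdd x y) (TAdd x' y')
  | cong_scale a x x' : dcong x x' -> dcong (TScale a x) (TScale a x')
  | cong_l x x' y y' : dcong x x' -> dcong y y' -> dcong (TL x y) (TL x' y')
  | cong_r x x' y y' : dcong x x' -> dcong y y' -> dcong (TR x y) (TR x' y')
  | cong_addA x y z : dcong (TAdd x (TAdd y z)) (TAdd (TAdd x y) z)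
  | cong_addC x y : dcong (TAdd x y) (TAdd y x)
  | cong_add0 x : dcong (TAdd TZero x) x
  | cong_addN x : dcong (TAdd (TOpp x) x) TZero
  | cong_scaleA a b x : dcong (TScale a (TScale b x)) (TScale (a * b) x)
  | cong_scale1 x : dcong (TScale 1 x) x
  | cong_scaleDr a x y :
      dcong (TScale a (TAdd x y)) (TAdd (TScale a x) (TScale a y))
  | cong_scaleDl a b x :
      dcong (TScale (a + b) x) (TAdd (TScale a x) (TScale b x))
  | cong_gen a v w :
      dcong (TGen (a *: v + w)) (TAdd (TScale a (TGen v)) (TGen w))
  | cong_ll a x x' y :
      dcong (TL (TAdd (TScale a x) x') y) (TAdd (TScale a (TL x y)) (TL x' y))
  | cong_lr a x y y' :
      dcong (TL x (TAdd (TScale a y) y')) (TAdd (TScale a (TL x y)) (TL x y'))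
  | cong_rl a x x' y :
      dcong (TR (TAdd (TScale a x) x') y) (TAdd (TScale a (TR x y)) (TR x' y))
  | cong_rr a x y y' :
      dcong (TR x (TAdd (TScale a y) y')) (TAdd (TScale a (TR x y)) (TR x y'))
  | cong_1 x y z : dcong (TL (TL x y) z) (TL x (TR y z))
  | cong_2 x y z : dcong (TL (TL x y) z) (TL x (TL y z))
  | cong_3 x y z : dcong (TL (TR x y) z) (TR x (TL y z))
  | cong_4 x y z : dcong (TR (TL x y) z) (TR x (TR y z))
  | cong_5 x y z : dcong (TR (TR x y) z) (TR x (TR y z)).

HB.instance Definition _ := gen_eqMixin dterm.
HB.instance Definition _ := gen_choiceMixin dterm.

Definition dcongb (x y : dterm) : bool := `[< dcong x y >].

Lemma dcongb_equiv : equiv_class_of dcongb.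
Proof.
split=> [x|x y|y x z].
- by apply/asboolP; exact: cong_refl.
- by apply/asboolP/asboolP; exact: cong_sym.
- by move=> /asboolP xy /asboolP yz; apply/asboolP; exact: cong_trans xy yz.
Qed.

Canonical dcong_equiv := EquivRelPack dcongb_equiv.
Canonical dcong_enc := defaultEncModRel dcongb.

Definition fterm := {eq_quot dcongb}%qT.
HB.instance Definition _ := Choice.on fterm.

Definition fpi (x : dterm) : fterm := \pi_({eq_quot dcongb})%qT x.
Definition frepr (x : fterm) : dterm := repr (x : {eq_quot dcongb}%qT).

Lemma fpi_eq x y : fpi x = fpi y <-> dcong x y.
Proof.
rewrite /fpi; split => [/eqP|xy]; first by rewrite eqmodE => /asboolP.
by apply/eqP; rewrite eqmodE; apply/asboolP.
Qed.
Lemma freprK : cancel frepr fpi. Proof. exact: reprK. Qed.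
Lemma frepr_fpi x : dcong (frepr (fpi x)) x.
Proof. by apply/fpi_eq; rewrite freprK. Qed.
Lemma fpi_ind (P : fterm -> Prop) : (forall x, P (fpi x)) -> forall x, P x.
Proof. by move=> H x; rewrite -[x]freprK. Qed.

Definition fzero : fterm := fpi TZero.
Definition fopp (x : fterm) : fterm := fpi (TOpp (frepr x)).
Definition fadd (x y : fterm) : fterm := fpi (TAdd (frepr x) (frepr y)).
Definition fscale a (x : fterm) : fterm := fpi (TScale a (frepr x)).
Definition flp (x y : fterm) : fterm := fpi (TL (frepr x) (frepr y)).
Definition frp (x y : fterm) : fterm := fpi (TR (frepr x) (frepr y)).
Definition fgen (v : V) : fterm := fpi (TGen v).

Lemma fopp_pi x : fopp (fpi x) = fpi (TOpp x).
Proof. by apply/fpi_eq/cong_opp/frepr_fpi. Qed.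
Lemma fadd_pi x y : fadd (fpi x) (fpi y) = fpi (TAdd x y).
Proof. by apply/fpi_eq/cong_add; exact: frepr_fpi. Qed.
Lemma fscale_pi a x : fscale a (fpi x) = fpi (TScale a x).
Proof. by apply/fpi_eq/cong_scale/frepr_fpi. Qed.
Lemma flp_pi x y : flp (fpi x) (fpi y) = fpi (TL x y).
Proof. by apply/fpi_eq/cong_l; exact: frepr_fpi. Qed.
Lemma frp_pi x y : frp (fpi x) (fpi y) = fpi (TR x y).
Proof. by apply/fpi_eq/cong_r; exact: frepr_fpi. Qed.

Let fE := (fopp_pi, fadd_pi, fscale_pi, flp_pi, frp_pi).

Lemma faddA : associative fadd.
Proof.
by elim/fpi_ind=> x; elim/fpi_ind=> y; elim/fpi_ind=> z; rewrite !fE; apply/fpi_eq/cong_addA.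
Qed.
Lemma faddC : commutative fadd.
Proof. by elim/fpi_ind=> x; elim/fpi_ind=> y; rewrite !fE; apply/fpi_eq/cong_addC. Qed.
Lemma fadd0 : left_id fzero fadd.
Proof. by elim/fpi_ind=> x; rewrite !fE; apply/fpi_eq/cong_add0. Qed.
Lemma faddN : left_inverse fzero fopp fadd.
Proof. by elim/fpi_ind=> x; rewrite !fE; apply/fpi_eq/cong_addN. Qed.
HB.instance Definition _ := GRing.isZmodule.Build fterm faddA faddC fadd0 faddN.

Lemma fscaleA a b v : fscale a (fscale b v) = fscale (a * b) v.
Proof. by elim/fpi_ind: v => x; rewrite !fE; apply/fpi_eq/cong_scaleA. Qed.
Lemma fscale1 : left_id 1 fscale.
Proof. by elim/fpi_ind=> x; rewrite !fE; apply/fpi_eq/cong_scale1. Qed.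
Lemma fscaleDr : right_distributive fscale +%R.
Proof.
move=> a; elim/fpi_ind=> x; elim/fpi_ind=> y; rewrite /GRing.add /= !fE.
by apply/fpi_eq/cong_scaleDr.
Qed.
Lemma fscaleDl v : {morph fscale^~ v : a b / a + b}.
Proof.
elim/fpi_ind: v => x a b; rewrite [in RHS]/GRing.add /= !fE.
by apply/fpi_eq/cong_scaleDl.
Qed.
HB.instance Definition _ := GRing.Zmodule_isLmodule.Build k fterm
  fscaleA fscale1 fscaleDr fscaleDl.

Lemma fpi0 : 0 = fpi TZero. Proof. by []. Qed.
Lemma fpiN x : - fpi x = fpi (TOpp x). Proof. exact: fopp_pi. Qed.
Lemma fpiD x y : fpi x + fpi y = fpi (TAdd x y). Proof. exact: fadd_pi. Qed.
Lemma fpiZ a x : a *: fpi x = fpi (TScale a x). Proof. exact: fscale_pi. Qed.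
Lemma flp_bilin : bilin flp.
Proof.
split; elim/fpi_ind=> x a; elim/fpi_ind=> y; elim/fpi_ind=> z.
  rewrite (fpiZ a y) (fpiD _ z) (flp_pi x (TAdd _ z)) (flp_pi x y) (flp_pi x z).
  by rewrite (fpiZ a (TL x y)) (fpiD _ (TL x z)); apply/fpi_eq; constructor.
rewrite (fpiZ a y) (fpiD _ z) (flp_pi (TAdd _ z) x) (flp_pi y x) (flp_pi z x).
by rewrite (fpiZ a (TL y x)) (fpiD _ (TL z x)); apply/fpi_eq; constructor.
Qed.
Lemma frp_bilin : bilin frp.
Proof.
split; elim/fpi_ind=> x a; elim/fpi_ind=> y; elim/fpi_ind=> z.
  rewrite (fpiZ a y) (fpiD _ z) (frp_pi x (TAdd _ z)) (frp_pi x y) (frp_pi x z).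
  by rewrite (fpiZ a (TR x y)) (fpiD _ (TR x z)); apply/fpi_eq; constructor.
rewrite (fpiZ a y) (fpiD _ z) (frp_pi (TAdd _ z) x) (frp_pi y x) (frp_pi z x).
by rewrite (fpiZ a (TR y x)) (fpiD _ (TR z x)); apply/fpi_eq; constructor.
Qed.
Definition free_prod := Biprod flp_bilin frp_bilin.

Lemma free_eqs : dias_eqs free_prod free_prod free_prod free_prod.
Proof.
move=> x y z; move: x y z.
elim/fpi_ind=> x; elim/fpi_ind=> y; elim/fpi_ind=> z /=.
rewrite !(flp_pi x y, frp_pi x y, flp_pi y z, frp_pi y z).
rewrite !(flp_pi _ z, frp_pi _ z, flp_pi x, frp_pi x).
by split; apply/fpi_eq; constructor.
Qed.

Definition free_dias : dialgebra := Dialgebra free_eqs.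

Lemma fgen_is_linear : linear (fgen : V -> free_dias).
Proof. move=> a v w; change (fgen (a *: v + w) = a *: fgen v + fgen w).
rewrite /fgen (fpiZ a (TGen v)) (fpiD _ (TGen w)).
by apply/fpi_eq; constructor. Qed.
Definition free_gen : {linear V -> free_dias} := mklin fgen_is_linear.

Variables (D : dialgebra) (f : {linear V -> D}).

Fixpoint teval (x : dterm) : D :=
  match x with
  | TGen v => f v
  | TZero => 0
  | TOpp x => - teval x
  | TAdd x y => teval x + teval y
  | TScale a x => a *: teval x
  | TL x y => teval x ⊣ teval y
  | TR x y => teval x ⊢ teval y
  end.

Lemma teval_cong x y : dcong x y -> teval x = teval y.
Proof.
elim=> //=; try by move=> *; congruence.
- by move=> *; rewrite addrA.
- by move=> *; rewrite addrC.
- by move=> *; rewrite add0r.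
- by move=> *; rewrite addNr.
- by move=> *; rewrite scalerA.
- by move=> *; rewrite scale1r.
- by move=> *; rewrite scalerDr.
- by move=> *; rewrite scalerDl.
- by move=> *; rewrite linearP.
- by move=> a u u' v; rewrite (lprod_bilin (dprod D)).2.
- by move=> a u v v'; rewrite (lprod_bilin (dprod D)).1.
- by move=> a u u' v; rewrite (rprod_bilin (dprod D)).2.
- by move=> a u v v'; rewrite (rprod_bilin (dprod D)).1.
all: by move=> u v w; case: (dprod_eqs (teval u) (teval v) (teval w)).
Qed.

Definition free_lift_fun (x : free_dias) : D := teval (frepr x).
Lemma free_lift_pi x : free_lift_fun (fpi x) = teval x.
Proof. exact/teval_cong/frepr_fpi. Qed.
Lemma free_lift_linear : linear free_lift_fun.
Proof.
move=> a; elim/fpi_ind=> x; elim/fpi_ind=> y.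
by rewrite (fpiZ a x) (fpiD _ y) !free_lift_pi.
Qed.
Lemma free_lift_l (x y : free_dias) :
  free_lift_fun (x ⊣ y) = free_lift_fun x ⊣ free_lift_fun y.
Proof.
by move: x y; elim/fpi_ind=> x; elim/fpi_ind=> y; rewrite /= flp_pi !free_lift_pi.
Qed.
Lemma free_lift_r (x y : free_dias) :
  free_lift_fun (x ⊢ y) = free_lift_fun x ⊢ free_lift_fun y.
Proof.
by move: x y; elim/fpi_ind=> x; elim/fpi_ind=> y; rewrite /= frp_pi !free_lift_pi.
Qed.

Definition free_lift : dias_hom free_dias D :=
  @DiasHom free_dias D (mklin free_lift_linear) free_lift_l free_lift_r.

Lemma free_lift_gen v : free_lift (free_gen v) = f v.
Proof. exact: (free_lift_pi (TGen v)). Qed.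

Lemma free_hom_ext (g h : dias_hom free_dias D) :
  (forall v, g (free_gen v) = h (free_gen v)) -> g = h.
Proof.
move=> gh; apply: dias_hom_ext; elim/fpi_ind.
elim=> [v||x IH|x IHx y IHy|a x IH|x IHx y IHy|x IHx y IHy].
- exact: gh.
- by rewrite -fpi0 !linear0.
- by rewrite -fpiN !linearN IH.
- by rewrite -fpiD !linearD IHx IHy.
- by rewrite -fpiZ !linearZ /= IH.
- by have := flp_pi x y; move=> /= <-; rewrite !dhom_l IHx IHy.
- by have := frp_pi x y; move=> /= <-; rewrite !dhom_r IHx IHy.
Qed.

End Free.

End Dialgebra.

Section Leibniz.
Variable k : comPzRingType.

Record leibniz := Leibniz {
  lcar :> lmodType k;
  lbr : lcar -> lcar -> lcar;
  lbr_bilin : bilin lbr;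
  lbr_eq : forall x y z,
    lbr x (lbr y z) = lbr (lbr x y) z - lbr (lbr x z) y
}.

Record lb_hom (g h : leibniz) := LbHom {
  lbh_lin :> {linear g -> h};
  lbh_br : forall x y, lbh_lin (lbr x y) = lbr (lbh_lin x) (lbh_lin y)
}.

Lemma lb_hom_ext g h (a b : lb_hom g h) : a =1 b -> a = b.
Proof.
case: a b => [a aP] [b bP] /= /linear_ext ab.
by move: aP bP; rewrite ab => *; congr LbHom; exact: Prop_irrelevance.
Qed.

Definition lb_id g : lb_hom g g.
Proof. by exists (mklin (f := id) (fun _ _ _ => erefl)). Defined.

Definition lb_comp g h i (b : lb_hom h i) (a : lb_hom g h) : lb_hom g i.
Proof.
by exists (mklin (f := b \o a) (linearP (b \o a))) => x y /=; rewrite !lbh_br.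
Defined.

Record lb_action (g q : leibniz) := LbAction {
  blact : g -> q -> q;
  bract : q -> g -> q;
  blact_bilin : bilin blact;
  bract_bilin : bilin bract;
  bact_gqq : forall (x : g) (y z : q),
    blact x (lbr y z) = lbr (blact x y) z - lbr (blact x z) y;
  bact_qgq : forall (x : q) (y : g) (z : q),
    lbr x (blact y z) = lbr (bract x y) z - bract (lbr x z) y;
  bact_qqg : forall (x y : q) (z : g),
    lbr x (bract y z) = bract (lbr x y) z - lbr (bract x z) y;
  bact_qgg : forall (x : q) (y z : g),
    bract x (lbr y z) = bract (bract x y) z - bract (bract x z) y;
  bact_gqg : forall (x : g) (y : q) (z : g),
    blact x (bract y z) = bract (blact x y) z - blact (lbr x z) y;
  bact_ggq : forall (x y : g) (z : q),
    blact x (blact y z) = blact (lbr x y) z - bract (blact x z) y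
}.

Record xlb := XLb {
  xl_q : leibniz;
  xl_g : leibniz;
  xl_nu : lb_hom xl_q xl_g;
  xl_act : lb_action xl_g xl_q;
  xl_nu_lact : forall x q, xl_nu (blact xl_act x q) = lbr x (xl_nu q);
  xl_nu_ract : forall q x, xl_nu (bract xl_act q x) = lbr (xl_nu q) x;
  xl_peiffer_l : forall q q', blact xl_act (xl_nu q) q' = lbr q q';
  xl_peiffer_r : forall q q', bract xl_act q (xl_nu q') = lbr q q'
}.

Record xlb_hom (A B : xlb) := XLbHom {
  xlh_q : lb_hom (xl_q A) (xl_q B);
  xlh_g : lb_hom (xl_g A) (xl_g B);
  xlh_nu : forall q, xl_nu B (xlh_q q) = xlh_g (xl_nu A q);
  xlh_lact : forall x q,
    xlh_q (blact (xl_act A) x q) = blact (xl_act B) (xlh_g x) (xlh_q q);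
  xlh_ract : forall q x,
    xlh_q (bract (xl_act A) q x) = bract (xl_act B) (xlh_q q) (xlh_g x)
}.

Lemma xlb_hom_ext A B (f g : xlb_hom A B) :
  xlh_q f =1 xlh_q g -> xlh_g f =1 xlh_g g -> f = g.
Proof.
case: f g => [f1 f2 a b c] [g1 g2 a' b' c'] /= /lb_hom_ext e1 /lb_hom_ext e2.
move: a b c a' b' c'; rewrite e1 e2 => *.
by congr XLbHom; exact: Prop_irrelevance.
Qed.

Definition xlb_id A : xlb_hom A A.
Proof. by exists (lb_id _) (lb_id _). Defined.

Definition xlb_comp A B C (g : xlb_hom B C) (f : xlb_hom A B) : xlb_hom A C.
Proof.
exists (lb_comp (xlh_q g) (xlh_q f)) (lb_comp (xlh_g g) (xlh_g f)).
- by move=> l /=; rewrite !xlh_nu.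
- by move=> x l /=; rewrite !xlh_lact.
- by move=> l x /=; rewrite !xlh_ract.
Defined.

Definition XLb_cat : category.
Proof.
by exists xlb xlb_hom xlb_id xlb_comp; move=> *; apply: xlb_hom_ext.
Defined.

Section Semidirect.
Variables (g q : leibniz) (a : lb_action g q).

Definition sd_br (u v : q * g) : q * g :=
  (lbr u.1 v.1 + bract a u.1 v.2 + blact a u.2 v.1, lbr u.2 v.2).

Lemma sd_bilin : bilin sd_br.
Proof.
have [l1 l2] := lbr_bilin q; have [g1 g2] := lbr_bilin g.
have [a1 a2] := blact_bilin a; have [b1 b2] := bract_bilin a.
split=> u c v w; congr pair => /=.
- by rewrite l1 a1 b1 !scalerDr; rewrite [X in X + _ = _]addrACA [LHS]addrACA.
- exact: g1.
- by rewrite l2 a2 b2 !scalerDr; rewrite [X in X + _ = _]addrACA [LHS]addrACA.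
- exact: g2.
Qed.

Lemma sd_eq x y z : sd_br x (sd_br y z) =
  sd_br (sd_br x y) z - sd_br (sd_br x z) y.
Proof.
case: x y z => [x x'] [y y'] [z z']; congr pair => /=; last exact: lbr_eq.
rewrite !(bilinDl (lbr_bilin q)) !(bilinDr (lbr_bilin q)).
rewrite !(bilinDr (blact_bilin a)) !(bilinDl (bract_bilin a)).
rewrite lbr_eq bact_qgq bact_qqg bact_qgg bact_gqq bact_gqg bact_ggq !opprD !addrA.
by rewrite [LHS](ACl (1*5*9*3*7*11*13*2*4*10*6*8*14*12)).
Qed.

Definition semidirect : leibniz := Leibniz sd_bilin sd_eq.

End Semidirect.

End Leibniz.

Section LbFunctor.
Variable k : comPzRingType.

(* The two orders of the variables use different products for an action. *)
Definition dbr (X Y A : lmodType k) (p : biprod X Y A) (p' : biprod Y X A) :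
  X -> Y -> A := fun x y => x ⊣[p] y - y ⊢[p'] x.

Lemma dbr_bilin (X Y A : lmodType k) (p : biprod X Y A) (p' : biprod Y X A) :
  bilin (dbr p p').
Proof.
have [l1 l2] := lprod_bilin p; have [r1 r2] := rprod_bilin p'.
split=> u a v w; rewrite /dbr; first by rewrite l1 r2 scalerBr opprD addrACA.
by rewrite l2 r1 scalerBr opprD addrACA.
Qed.

Lemma dbr_leibniz (X Y Z A B C W : lmodType k)
    (XY : biprod X Y A) (YX : biprod Y X A) (YZ : biprod Y Z B)
    (ZY : biprod Z Y B) (XZ : biprod X Z C) (ZX : biprod Z X C)
    (XB : biprod X B W) (BX : biprod B X W) (AZ : biprod A Z W)
    (ZA : biprod Z A W) (CY : biprod C Y W) (YC : biprod Y C W) :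
  dias_eqs XY YZ AZ XB -> dias_eqs XZ ZY CY XB -> dias_eqs YX XZ AZ YC ->
  dias_eqs ZX XY CY ZA -> dias_eqs ZY YX BX ZA -> dias_eqs YZ ZX BX YC ->
  forall x y z, dbr XB BX x (dbr YZ ZY y z)
    = dbr AZ ZA (dbr XY YX x y) z - dbr CY YC (dbr XZ ZX x z) y.
Proof.
move=> h1 h2 h3 h4 h5 h6 x y z; rewrite /dbr.
rewrite !(bilinBl (lprod_bilin _)) !(bilinBr (lprod_bilin _)).
rewrite !(bilinBl (rprod_bilin _)) !(bilinBr (rprod_bilin _)).
have [_ e1 _ _ _] := h1 x y z; have [e2 _ _ _ _] := h2 x z y.
have [_ _ e3 _ _] := h3 y x z; have [_ _ e4 _ _] := h4 z x y.
have [_ _ _ _ e5] := h5 z y x; have [_ _ _ e6 _] := h6 y z x.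
rewrite e1 e2 e3 e4 e5 e6 !opprB.
set a := x ⊣[XB] (y ⊣[YZ] z); set b := x ⊣[XB] (z ⊢[ZY] y).
set c := y ⊢[YC] (z ⊢[ZX] x); set d := z ⊢[ZA] (y ⊢[YX] x).
set e := y ⊢[YC] (x ⊣[XZ] z); set f := z ⊢[ZA] (x ⊣[XY] y).
by rewrite !addrA [RHS](ACl (1*8*3*6*(2*5)*(4*7)))/= !addNr !addr0.
Qed.

Definition Lb (D : dialgebra k) : leibniz k :=
  @Leibniz k D (dbr (dprod D) (dprod D)) (dbr_bilin _ _)
    (let H := @dprod_eqs k D in dbr_leibniz H H H H H H).

Lemma Lb_map_br (D E : dialgebra k) (f : dias_hom D E) (x y : Lb D) :
  f (lbr x y) = lbr (f x : Lb E) (f y).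
Proof. by rewrite /= /dbr linearB /= dhom_l dhom_r. Qed.

Definition Lb_map (D E : dialgebra k) (f : dias_hom D E) :
  lb_hom (Lb D) (Lb E) := @LbHom k (Lb D) (Lb E) f (Lb_map_br f).

Definition Lb_action (D L : dialgebra k) (a : dias_action D L) :
  lb_action (Lb D) (Lb L).
Proof.
exists (dbr (lact a) (ract a)) (dbr (ract a) (lact a)) => *.
- exact: dbr_bilin.
- exact: dbr_bilin.
- apply: dbr_leibniz; solve [ exact: act_DLL | exact: act_LDL | exact: act_LLD ].
- apply: dbr_leibniz; solve [ exact: act_DLL | exact: act_LDL | exact: act_LLD ].
- apply: dbr_leibniz; solve [ exact: act_DLL | exact: act_LDL | exact: act_LLD ].
- apply: dbr_leibniz; solve [ exact: act_DDL | exact: act_LDD | exact: act_DLD ].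
- apply: dbr_leibniz; solve [ exact: act_DDL | exact: act_LDD | exact: act_DLD ].
- apply: dbr_leibniz; solve [ exact: act_DDL | exact: act_LDD | exact: act_DLD ].
Defined.

Definition XLb_obj (A : xdias k) : xlb k.
Proof.
exists (Lb (xd_L A)) (Lb (xd_D A)) (Lb_map (xd_mu A)) (Lb_action (xd_act A)).
- by move=> x l /=; rewrite /dbr linearB /= (xd_mu_lact _ _).1 (xd_mu_ract _ _).2.
- by move=> l x /=; rewrite /dbr linearB /= (xd_mu_ract _ _).1 (xd_mu_lact _ _).2.
- by move=> l l' /=; rewrite /dbr (xd_peiffer_l _ _).1 (xd_peiffer_r _ _).2.
- by move=> l l' /=; rewrite /dbr (xd_peiffer_r _ _).1 (xd_peiffer_l _ _).2.
Defined.

Definition XLb_map (A B : xdias k) (f : xdias_hom A B) :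
  xlb_hom (XLb_obj A) (XLb_obj B).
Proof.
exists (Lb_map (xdh_L f) : lb_hom (xl_q (XLb_obj A)) (xl_q (XLb_obj B)))
       (Lb_map (xdh_D f) : lb_hom (xl_g (XLb_obj A)) (xl_g (XLb_obj B))).
- exact: xdh_mu.
- by move=> x l /=; rewrite /dbr linearB /= (xdh_lact f _ _).1 (xdh_ract f _ _).2.
- by move=> l x /=; rewrite /dbr linearB /= (xdh_ract f _ _).1 (xdh_lact f _ _).2.
Defined.

Definition XLb_functor : functor (XDias_cat k) (XLb_cat k).
Proof.
exists (XLb_obj : XDias_cat k -> XLb_cat k) XLb_map;
  by move=> *; apply: xlb_hom_ext.
Defined.

End LbFunctor.

Section Ud.
Variable k : comPzRingType.
Implicit Types g h : leibniz k.

Definition ud_rel g : set (free_dias g) :=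
  [set z | exists x y : g,
     z = free_gen g (lbr x y) - free_gen g x ⊣ free_gen g y
         + free_gen g y ⊢ free_gen g x].

Definition Ud g : dialgebra k := quot_dias (ideal_gen_ideal (@ud_rel g)).

Definition ud_pi g : dias_hom (free_dias g) (Ud g) :=
  quot_pi (ideal_gen_ideal (@ud_rel g)).

Lemma ud_unit_br g (x y : g) :
  ud_pi g (free_gen g (lbr x y)) =
  lbr (ud_pi g (free_gen g x) : Lb (Ud g)) (ud_pi g (free_gen g y)).
Proof.
change (ud_pi g (free_gen g (lbr x y)) =
  ud_pi g (free_gen g x) ⊣ ud_pi g (free_gen g y)
  - ud_pi g (free_gen g y) ⊢ ud_pi g (free_gen g x)).
rewrite -dhom_l -dhom_r; apply/eqP; rewrite -subr_eq0 opprB addrA addrAC.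
rewrite -linearB -linearD; apply/eqP/quot_pi_eq0.
by move=> I II; apply; exists x, y.
Qed.

Definition ud_unit g : lb_hom g (Lb (Ud g)) :=
  @LbHom k g (Lb (Ud g))
    (mklin (f := ud_pi g \o free_gen g) (linearP (ud_pi g \o free_gen g)))
    (@ud_unit_br g).

Lemma ud_hom_ext g (D : dialgebra k) (f f' : dias_hom (Ud g) D) :
  (forall x, f (ud_unit g x) = f' (ud_unit g x)) -> f = f'.
Proof.
move=> H; apply: quot_hom_ext => x.
have E : dias_comp f (ud_pi g) = dias_comp f' (ud_pi g).
  by apply: free_hom_ext => v; exact: H.
exact: (congr1 (fun h : dias_hom _ _ => h x) E).
Qed.

Lemma ud_lift_subproof g (D : dialgebra k) (f : lb_hom g (Lb D)) :
  ideal_gen (@ud_rel g) `<=` dker (free_lift (f : {linear g -> D})).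
Proof.
move=> x; apply; first exact: dker_ideal.
move=> _ [y [z ->]]; rewrite /dker.
change (free_lift (f : {linear g -> D}) (free_gen g (lbr y z)
  - free_gen g y ⊣ free_gen g z + free_gen g z ⊢ free_gen g y) = 0).
rewrite linearD linearB dhom_l dhom_r !free_lift_gen lbh_br /= /dbr.
by rewrite addrAC subrK subrr.
Qed.

Definition ud_lift g (D : dialgebra k) (f : lb_hom g (Lb D)) :
  dias_hom (Ud g) D := quot_lift (ideal_gen_ideal _) (ud_lift_subproof f).

Lemma ud_liftE g (D : dialgebra k) (f : lb_hom g (Lb D)) x :
  ud_lift f (ud_unit g x) = f x.
Proof.
rewrite -(free_lift_gen (f : {linear g -> D}) x).
exact: (quot_liftE (ideal_gen_ideal _) (ud_lift_subproof f)).
Qed.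

Definition Ud_map g h (f : lb_hom g h) : dias_hom (Ud g) (Ud h) :=
  ud_lift (lb_comp (ud_unit h) f).

Lemma Ud_mapE g h (f : lb_hom g h) x : Ud_map f (ud_unit g x) = ud_unit h (f x).
Proof. exact: ud_liftE. Qed.

Lemma Ud_map_id g : Ud_map (lb_id g) = dias_id (Ud g).
Proof. by apply: ud_hom_ext => x; rewrite Ud_mapE. Qed.

Lemma Ud_map_comp g h i (b : lb_hom h i) (a : lb_hom g h) :
  Ud_map (lb_comp b a) = dias_comp (Ud_map b) (Ud_map a).
Proof.
apply: ud_hom_ext => x; rewrite Ud_mapE.
change (ud_unit i (b (a x)) = Ud_map b (Ud_map a (ud_unit g x))).
by rewrite !Ud_mapE.
Qed.

End Ud.

Section XUd.
Variable k : comPzRingType.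

Section Obj.
Variable A : xlb k.
Let q := xl_q A.
Let g := xl_g A.

Definition sdp : leibniz k := semidirect (xl_act A).

Definition sd_s : lb_hom sdp g.
Proof. by exists (mklin (f := (snd : sdp -> g)) (fun _ _ _ => erefl)). Defined.

Definition sd_t_fun (u : sdp) : g := xl_nu A u.1 + u.2.
Lemma sd_t_linear : linear sd_t_fun.
Proof. by move=> a u v; rewrite /sd_t_fun /= linearP scalerDr addrACA. Qed.
Lemma sd_t_br u v : sd_t_fun (lbr u v) = lbr (sd_t_fun u) (sd_t_fun v).
Proof.
rewrite /sd_t_fun /= !linearD /= lbh_br xl_nu_lact xl_nu_ract.
by rewrite !(bilinDl (lbr_bilin _)) !(bilinDr (lbr_bilin _)) !addrA.
Qed.
Definition sd_t : lb_hom sdp g := @LbHom k sdp g (mklin sd_t_linear) sd_t_br.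

Definition sd_i_fun (x : g) : sdp := (0, x).
Lemma sd_i_linear : linear sd_i_fun.
Proof. by move=> a u v; congr pair; rewrite /= scaler0 addr0. Qed.
Lemma sd_i_br u v : sd_i_fun (lbr u v) = lbr (sd_i_fun u) (sd_i_fun v).
Proof.
congr pair => /=; rewrite (bilin0l (lbr_bilin _)) (bilin0l (bract_bilin _)).
by rewrite (bilin0r (blact_bilin _)) !addr0.
Qed.
Definition sd_i : lb_hom g sdp := @LbHom k g sdp (mklin sd_i_linear) sd_i_br.

Definition ud_s := Ud_map sd_s.
Definition ud_t := Ud_map sd_t.

Definition UdX : dialgebra k := quot_dias (xset_ideal ud_s ud_t).
Definition udx_pi : dias_hom (Ud sdp) UdX := quot_pi (xset_ideal ud_s ud_t).

Definition sbar : dias_hom UdX (Ud g) := quot_lift (xset_ideal _ _) (@xset_sub_s k _ _ ud_s ud_t).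
Definition tbar : dias_hom UdX (Ud g) := quot_lift (xset_ideal _ _) (@xset_sub_t k _ _ ud_s ud_t).
(* A section of sbar (see sibar), hence injective: it embeds Ud g in UdX. *)
Definition ibar : dias_hom (Ud g) UdX := dias_comp udx_pi (Ud_map sd_i).

Lemma sbarE x : sbar (udx_pi x) = ud_s x.
Proof. exact: (quot_liftE (xset_ideal _ _) (@xset_sub_s k _ _ ud_s ud_t)). Qed.
Lemma tbarE x : tbar (udx_pi x) = ud_t x.
Proof. exact: (quot_liftE (xset_ideal _ _) (@xset_sub_t k _ _ ud_s ud_t)). Qed.

Lemma ud_si x : ud_s (Ud_map sd_i x) = x.
Proof.
have E : dias_comp ud_s (Ud_map sd_i) = dias_id (Ud g).
  rewrite -Ud_map_comp -Ud_map_id; congr Ud_map.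
  exact: lb_hom_ext.
exact: (congr1 (fun h : dias_hom _ _ => h x) E).
Qed.
Lemma ud_ti x : ud_t (Ud_map sd_i x) = x.
Proof.
have E : dias_comp ud_t (Ud_map sd_i) = dias_id (Ud g).
  rewrite -Ud_map_comp -Ud_map_id; congr Ud_map.
  by apply: lb_hom_ext => y; rewrite /= /sd_t_fun /= linear0 add0r.
exact: (congr1 (fun h : dias_hom _ _ => h x) E).
Qed.

Lemma sibar x : sbar (ibar x) = x.
Proof. exact: etrans (sbarE _) (ud_si x). Qed.
Lemma tibar x : tbar (ibar x) = x.
Proof. exact: etrans (tbarE _) (ud_ti x). Qed.

Lemma udx_annihil (a b : UdX) : sbar a = 0 -> tbar b = 0 ->
  [/\ a ⊣ b = 0, b ⊣ a = 0, a ⊢ b = 0 & b ⊢ a = 0].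
Proof.
move: a b; elim/quot_pi_ind => a; elim/quot_pi_ind => b.
move=> sa tb.
have {}sa : dker ud_s a := etrans (esym (sbarE a)) sa.
have {}tb : dker ud_t b := etrans (esym (tbarE b)) tb.
have [h1 h2 h3 h4] := xset_prod sa tb.
by split; rewrite -?dhom_l -?dhom_r; apply/quot_pi_eq0.
Qed.

Lemma udx_peiffer (a b : UdX) : sbar b = 0 ->
  [/\ ibar (tbar a) ⊣ b = a ⊣ b, ibar (tbar a) ⊢ b = a ⊢ b,
      b ⊣ ibar (tbar a) = b ⊣ a & b ⊢ ibar (tbar a) = b ⊢ a].
Proof.
move=> sb; have ta : tbar (ibar (tbar a) - a) = 0 by rewrite linearB tibar subrr.
have [h1 h2 h3 h4] := udx_annihil sb ta.
rewrite (bilinBr (lprod_bilin _)) in h1; rewrite (bilinBl (lprod_bilin _)) in h2.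
rewrite (bilinBr (rprod_bilin _)) in h3; rewrite (bilinBl (rprod_bilin _)) in h4.
by split; apply/eqP; rewrite -subr_eq0; apply/eqP.
Qed.

Definition XUd_obj : xdias k.
Proof.
exists (ker_dias sbar) (Ud g) (dias_comp tbar (ker_incl sbar))
       (ker_action sbar ibar).
- move=> x l; change (tbar (ibar x ⊣ kval l) = x ⊣ tbar (kval l) /\
    tbar (ibar x ⊢ kval l) = x ⊢ tbar (kval l)).
  by rewrite dhom_l dhom_r tibar.
- move=> l x; change (tbar (kval l ⊣ ibar x) = tbar (kval l) ⊣ x /\
    tbar (kval l ⊢ ibar x) = tbar (kval l) ⊢ x).
  by rewrite dhom_l dhom_r tibar.
- move=> l l'; have [h1 h2 _ _] := udx_peiffer (kval l) (kval_eq0 l').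
  by split; apply: ker_inj.
- move=> l l'; have [_ _ h1 h2] := udx_peiffer (kval l') (kval_eq0 l).
  by split; apply: ker_inj.
Defined.

End Obj.

Section Map.
Variables (A B : xlb k) (f : xlb_hom A B).

Definition sd_map_fun (u : sdp A) : sdp B := (xlh_q f u.1, xlh_g f u.2).
Lemma sd_map_linear : linear sd_map_fun.
Proof. by move=> a u v; congr pair; rewrite /= linearP. Qed.
Lemma sd_map_br u v : sd_map_fun (lbr u v) = lbr (sd_map_fun u) (sd_map_fun v).
Proof.
by congr pair => /=; rewrite ?linearD /= ?lbh_br // xlh_lact xlh_ract.
Qed.
Definition sd_map : lb_hom (sdp A) (sdp B) :=
  @LbHom k (sdp A) (sdp B) (mklin sd_map_linear) sd_map_br.

Lemma ud_s_map x : ud_s B (Ud_map sd_map x) = Ud_map (xlh_g f) (ud_s A x).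
Proof.
have E : dias_comp (ud_s B) (Ud_map sd_map)
         = dias_comp (Ud_map (xlh_g f)) (ud_s A).
  by rewrite -!Ud_map_comp; congr Ud_map; exact: lb_hom_ext.
exact: (congr1 (fun h : dias_hom _ _ => h x) E).
Qed.
Lemma ud_t_map x : ud_t B (Ud_map sd_map x) = Ud_map (xlh_g f) (ud_t A x).
Proof.
have E : dias_comp (ud_t B) (Ud_map sd_map)
         = dias_comp (Ud_map (xlh_g f)) (ud_t A).
  rewrite -!Ud_map_comp; congr Ud_map; apply: lb_hom_ext => y.
  by rewrite /= /sd_t_fun /= linearD xlh_nu.
exact: (congr1 (fun h : dias_hom _ _ => h x) E).
Qed.
Lemma ud_i_map x :
  Ud_map sd_map (Ud_map (sd_i A) x) = Ud_map (sd_i B) (Ud_map (xlh_g f) x).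
Proof.
have E : dias_comp (Ud_map sd_map) (Ud_map (sd_i A))
         = dias_comp (Ud_map (sd_i B)) (Ud_map (xlh_g f)).
  rewrite -!Ud_map_comp; congr Ud_map; apply: lb_hom_ext => y.
  by congr pair; rewrite /= linear0.
exact: (congr1 (fun h : dias_hom _ _ => h x) E).
Qed.

Lemma udx_map_subproof :
  xset (ud_s A) (ud_t A) `<=` dker (dias_comp (udx_pi B) (Ud_map sd_map)).
Proof.
apply: xset_sub => a b sa tb.
have {}sa : dker (ud_s B) (Ud_map sd_map a).
  apply: etrans (ud_s_map a) _.
  by rewrite (_ : ud_s A a = 0) ?linear0.
have {}tb : dker (ud_t B) (Ud_map sd_map b).
  apply: etrans (ud_t_map b) _.
  by rewrite (_ : ud_t A b = 0) ?linear0.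
have [h1 h2 h3 h4] := xset_prod sa tb.
by split; rewrite ?dhom_l ?dhom_r -?dhom_l -?dhom_r; apply/quot_pi_eq0;
  rewrite ?dhom_l ?dhom_r.
Qed.

Definition udx_map : dias_hom (UdX A) (UdX B) :=
  quot_lift (xset_ideal _ _) udx_map_subproof.

Lemma udx_mapE x : udx_map (udx_pi A x) = udx_pi B (Ud_map sd_map x).
Proof. exact: (quot_liftE (xset_ideal _ _) udx_map_subproof). Qed.

Lemma sbar_map x : sbar B (udx_map x) = Ud_map (xlh_g f) (sbar A x).
Proof.
elim/quot_pi_ind: x => x.
exact: etrans (congr1 (sbar B) (udx_mapE x)) (etrans (sbarE _) (etrans
  (ud_s_map x) (congr1 (Ud_map (xlh_g f)) (esym (sbarE x))))).
Qed.
Lemma tbar_map x : tbar B (udx_map x) = Ud_map (xlh_g f) (tbar A x).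
Proof.
elim/quot_pi_ind: x => x.
exact: etrans (congr1 (tbar B) (udx_mapE x)) (etrans (tbarE _) (etrans
  (ud_t_map x) (congr1 (Ud_map (xlh_g f)) (esym (tbarE x))))).
Qed.
Lemma ibar_map x : udx_map (ibar A x) = ibar B (Ud_map (xlh_g f) x).
Proof.
exact: etrans (udx_mapE _) (congr1 (udx_pi B) (ud_i_map x)).
Qed.

Lemma xud_ker_eq0 (l : ker_dias (sbar A)) : sbar B (udx_map (kval l)) = 0.
Proof. by rewrite sbar_map kval_eq0 linear0. Qed.

Definition xud_ker_fun (l : ker_dias (sbar A)) : ker_dias (sbar B) :=
  mkker (xud_ker_eq0 l).
Lemma xud_ker_linear : linear xud_ker_fun.
Proof.
move=> a u v; apply: ker_inj.
apply: etrans _ (esym (kval_linear a (xud_ker_fun u) (xud_ker_fun v))).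
exact: etrans (congr1 udx_map (kval_linear a u v)) (linearP udx_map a _ _).
Qed.

Definition xud_ker : dias_hom (ker_dias (sbar A)) (ker_dias (sbar B)).
Proof.
exists (mklin xud_ker_linear) => x y; apply: ker_inj; [exact: dhom_l|exact: dhom_r].
Defined.

Definition XUd_map : xdias_hom (XUd_obj A) (XUd_obj B).
Proof.
exists (xud_ker : dias_hom (xd_L (XUd_obj A)) (xd_L (XUd_obj B)))
       (Ud_map (xlh_g f) : dias_hom (xd_D (XUd_obj A)) (xd_D (XUd_obj B))).
- by move=> l; exact: tbar_map.
- move=> x l; split; apply: ker_inj.
    exact: etrans (dhom_l _ _ _) (congr2 _ (ibar_map x) erefl).
  exact: etrans (dhom_r _ _ _) (congr2 _ (ibar_map x) erefl).
- move=> l x; split; apply: ker_inj.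
    exact: etrans (dhom_l _ _ _) (congr2 _ erefl (ibar_map x)).
  exact: etrans (dhom_r _ _ _) (congr2 _ erefl (ibar_map x)).
Defined.

End Map.

Lemma udx_map_id A : udx_map (xlb_id A) = dias_id (UdX A).
Proof.
apply: quot_hom_ext => x; apply: etrans (udx_mapE _ x) _.
congr (udx_pi A _); have -> : sd_map (xlb_id A) = lb_id (sdp A).
  by apply: lb_hom_ext => -[].
by rewrite Ud_map_id.
Qed.

Lemma udx_map_comp A B C (g : xlb_hom B C) (f : xlb_hom A B) :
  udx_map (xlb_comp g f) = dias_comp (udx_map g) (udx_map f).
Proof.
apply: quot_hom_ext => x; apply: etrans (udx_mapE _ x) _.
have -> : sd_map (xlb_comp g f) = lb_comp (sd_map g) (sd_map f).
  exact: lb_hom_ext.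
rewrite Ud_map_comp.
exact: esym (etrans (congr1 (udx_map g) (udx_mapE f x)) (udx_mapE g _)).
Qed.

Definition XUd_functor : functor (XLb_cat k) (XDias_cat k).
Proof.
exists (XUd_obj : XLb_cat k -> XDias_cat k) XUd_map.
- move=> A; apply: xdias_hom_ext => x.
    apply: ker_inj; exact: (congr1 (fun h : dias_hom _ _ => h (kval x))
                                   (udx_map_id A)).
  exact: (congr1 (fun h : dias_hom _ _ => h x) (Ud_map_id _)).
- move=> A B C g f; apply: xdias_hom_ext => x.
    apply: ker_inj; exact: (congr1 (fun h : dias_hom _ _ => h (kval x))
                                   (udx_map_comp g f)).
  exact: (congr1 (fun h : dias_hom _ _ => h x) (Ud_map_comp _ _)).
Defined.

End XUd.

(* Main.v *)
(* The unit of the adjunction at (nu : q -> g) sends g to the generators of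
   Ud g, and x in q to the class of the generator (x, 0) in Ud (q x| g) / X.

   For a crossed module (mu : L -> D), form the semidirect product dialgebra
   L x| D with its two maps to D, (l, d) |-> d and (l, d) |-> mu l + d; the
   crossed module axioms give that the second is a homomorphism and that
   the products of the two kernels vanish.  A morphism from (nu : q -> g) to
   XLb (mu : L -> D) gives a Leibniz homomorphism q x| g -> Lb (L x| D)
   compatible with these maps, hence Ud (q x| g) -> L x| D, which kills X; its
   restriction to kernels is the adjoint morphism.  Conversely a morphism out of
   XUd extends to Ud (q x| g) / X -> L x| D, because the source splits as
   Ker (sbar) + Ud g, and so it is determined by its values on generators. *)
Require Import Defs.
From mathcomp Require Import ssralg.
From mathcomp Require Import all_boot ssrAC.
From mathcomp Require Import boolp classical_sets.

Set Implicit Arguments.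
Unset Strict Implicit.
Unset Printing Implicit Defensive.

Import GRing.Theory.
Local Open Scope ring_scope.
Local Open Scope classical_set_scope.

(** * Bilinear maps: signs and products of differences *)

Section Bilinear.
Variables (k : comPzRingType) (U V W : lmodType k) (f : U -> V -> W).
Hypothesis bf : bilin f.

Lemma bilinNl u v : f (- u) v = - f u v.
Proof. by rewrite -sub0r (bilinBl bf) (bilin0l bf) sub0r. Qed.
Lemma bilinNr u v : f u (- v) = - f u v.
Proof. by rewrite -sub0r (bilinBr bf) (bilin0r bf) sub0r. Qed.

(** Serves the multiplicativity of [xext]: when u' and v' are the parts of u and v in [Ud g], the
    left side has the shape of the first component of a semidirect product. *)
Lemma bilin_sub_split u u' v v' :
  f (u - u') (v - v') + f (u - u') v' + f u' (v - v') = f u v - f u' v'.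
Proof.
by rewrite -(bilinDr bf) subrK (bilinBl bf) (bilinBr bf) addrA subrK.
Qed.

End Bilinear.

(** * Semidirect products of dialgebras *)

Section DialgebraSemidirect.
Variables (k : comPzRingType) (D L : dialgebra k) (a : dias_action D L).

Definition dsd_l (u v : L * D) : L * D :=
  (u.1 ⊣ v.1 + u.1 ⊣[ract a] v.2 + u.2 ⊣[lact a] v.1, u.2 ⊣ v.2).
Definition dsd_r (u v : L * D) : L * D :=
  (u.1 ⊢ v.1 + u.1 ⊢[ract a] v.2 + u.2 ⊢[lact a] v.1, u.2 ⊢ v.2).

Lemma dsd_l_bilin : bilin dsd_l.
Proof.
have [l1 l2] := lprod_bilin (dprod L); have [d1 d2] := lprod_bilin (dprod D).
have [a1 a2] := lprod_bilin (lact a); have [b1 b2] := lprod_bilin (ract a).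
split=> u c v w; congr pair => /=; rewrite ?d1 ?d2 //.
  by rewrite l1 a1 b1 !scalerDr; rewrite [X in X + _ = _]addrACA [LHS]addrACA.
by rewrite l2 a2 b2 !scalerDr; rewrite [X in X + _ = _]addrACA [LHS]addrACA.
Qed.

Lemma dsd_r_bilin : bilin dsd_r.
Proof.
have [l1 l2] := rprod_bilin (dprod L); have [d1 d2] := rprod_bilin (dprod D).
have [a1 a2] := rprod_bilin (lact a); have [b1 b2] := rprod_bilin (ract a).
split=> u c v w; congr pair => /=; rewrite ?d1 ?d2 //.
  by rewrite l1 a1 b1 !scalerDr; rewrite [X in X + _ = _]addrACA [LHS]addrACA.
by rewrite l2 a2 b2 !scalerDr; rewrite [X in X + _ = _]addrACA [LHS]addrACA.
Qed.

Definition dsd_prod : biprod (L * D)%type (L * D)%type (L * D)%type :=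
  Biprod dsd_l_bilin dsd_r_bilin.

Lemma dsd_eqs : dias_eqs dsd_prod dsd_prod dsd_prod dsd_prod.
Proof.
move=> [l x] [m y] [n z].
have [a1 a2 a3 a4 a5] := dprod_eqs l m n.
have [b1 b2 b3 b4 b5] := dprod_eqs x y z.
have [c1 c2 c3 c4 c5] := act_DLL a x m n.
have [d1 d2 d3 d4 d5] := act_LDL a l y n.
have [e1 e2 e3 e4 e5] := act_LLD a l m z.
have [f1 f2 f3 f4 f5] := act_LDD a l y z.
have [g1 g2 g3 g4 g5] := act_DLD a x m z.
have [h1 h2 h3 h4 h5] := act_DDL a x y n.
split; congr pair => //=;
  rewrite ?(bilinDl (lprod_bilin _)) ?(bilinDl (rprod_bilin _));
  rewrite ?(bilinDr (lprod_bilin _)) ?(bilinDr (rprod_bilin _)) !addrA;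
  (* Seven terms remain, one for each choice of L or D for the three variables other than DDD. The
     permutation lines them up with the right side, and each pair is an instance of one identity of
     L or of the action. *)
  rewrite [LHS](ACl (1*4*2*5*3*6*7)).
- by rewrite a1 c1 d1 e1 f1 g1 h1.
- by rewrite a2 c2 d2 e2 f2 g2 h2.
- by rewrite a3 c3 d3 e3 f3 g3 h3.
- by rewrite a4 c4 d4 e4 f4 g4 h4.
- by rewrite a5 c5 d5 e5 f5 g5 h5.
Qed.

Definition dias_semidirect : dialgebra k := Dialgebra dsd_eqs.

Definition dsd_snd : dias_hom dias_semidirect D.
Proof.
by exists (mklin (f := (snd : dias_semidirect -> D)) (fun _ _ _ => erefl)).
Defined.

Lemma dsd_inr_linear : linear (fun x : D => (0, x) : dias_semidirect).
Proof. by move=> c x y; congr pair; rewrite /= scaler0 addr0. Qed.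

Definition dsd_inr : dias_hom D dias_semidirect.
Proof.
exists (mklin dsd_inr_linear) => x y; congr pair => /=.
  rewrite (bilin0l (lprod_bilin _)) (bilin0l (lprod_bilin _)).
  by rewrite (bilin0r (lprod_bilin _)) !addr0.
rewrite (bilin0l (rprod_bilin _)) (bilin0l (rprod_bilin _)).
by rewrite (bilin0r (rprod_bilin _)) !addr0.
Defined.

End DialgebraSemidirect.

(** * The semidirect product of a crossed module of dialgebras *)

Section XDiasSemidirect.
Variables (k : comPzRingType) (B : xdias k).

Definition dsdp : dialgebra k := dias_semidirect (xd_act B).

Definition dsd_t_fun (u : dsdp) : xd_D B := xd_mu B u.1 + u.2.
Lemma dsd_t_linear : linear dsd_t_fun.
Proof. by move=> a u v; rewrite /dsd_t_fun /= linearP scalerDr addrACA. Qed.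

Definition dsd_t : dias_hom dsdp (xd_D B).
Proof.
exists (mklin dsd_t_linear) => u v; rewrite /= /dsd_t_fun /= !linearD /=.
  rewrite dhom_l (xd_mu_lact _ _).1 (xd_mu_ract _ _).1.
  by rewrite !(bilinDl (lprod_bilin _)) !(bilinDr (lprod_bilin _)) !addrA.
rewrite dhom_r (xd_mu_lact _ _).2 (xd_mu_ract _ _).2.
by rewrite !(bilinDl (rprod_bilin _)) !(bilinDr (rprod_bilin _)) !addrA.
Defined.

(** Here u = (l, 0) and v = (m, - mu m), so each product is a product of l and m minus the action of
    mu m on l, which is 0 by the Peiffer identities. *)
Lemma dsd_annihil (u v : dsdp) : dsd_snd _ u = 0 -> dsd_t v = 0 ->
  [/\ u ⊣ v = 0, v ⊣ u = 0, u ⊢ v = 0 & v ⊢ u = 0].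
Proof.
case: u v => [l x] [m y] /= -> /eqP; rewrite /dsd_t_fun addrC addr_eq0 /=.
move/eqP=> ->.
split; congr pair => /=;
  rewrite ?(bilin0l (lprod_bilin _)) ?(bilin0r (lprod_bilin _))
    ?(bilin0l (rprod_bilin _)) ?(bilin0r (rprod_bilin _)) ?addr0 //;
  rewrite ?(bilinNl (lprod_bilin _)) ?(bilinNr (lprod_bilin _))
    ?(bilinNl (rprod_bilin _)) ?(bilinNr (rprod_bilin _));
  by rewrite ?(xd_peiffer_l _ _).1 ?(xd_peiffer_l _ _).2
    ?(xd_peiffer_r _ _).1 ?(xd_peiffer_r _ _).2 subrr.
Qed.

(** [Lb] commutes with semidirect products: the first components consist of the same six terms in a
    different order. *)
Lemma Lb_dsd_br (u v : sdp (XLb_obj B)) :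
  (lbr u v : dsdp) = lbr (u : Lb dsdp) (v : Lb dsdp).
Proof.
congr pair => /=; rewrite /dbr /= !opprD !addrA.
by rewrite [LHS](ACl (1*3*5*2*6*4)).
Qed.

Definition Lb_dsd : lb_hom (sdp (XLb_obj B)) (Lb dsdp) :=
  @LbHom k (sdp (XLb_obj B)) (Lb dsdp)
    (mklin (f := (id : sdp (XLb_obj B) -> Lb dsdp)) (fun _ _ _ => erefl))
    Lb_dsd_br.

End XDiasSemidirect.

(** * The unit of the adjunction and its naturality *)

Section Unit.
Variables (k : comPzRingType) (A : xlb k).

Definition udx_gen : lb_hom (sdp A) (Lb (UdX A)) :=
  lb_comp (Lb_map (udx_pi A)) (ud_unit (sdp A)).

Lemma sbar_gen u : sbar A (udx_gen u) = ud_unit (xl_g A) u.2.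
Proof. exact: etrans (sbarE _) (Ud_mapE _ _). Qed.
Lemma tbar_gen u : tbar A (udx_gen u) = ud_unit (xl_g A) (xl_nu A u.1 + u.2).
Proof. exact: etrans (tbarE _) (Ud_mapE _ _). Qed.
Lemma ibar_gen x : ibar A (ud_unit (xl_g A) x) = udx_gen (0, x).
Proof. exact: (congr1 (fun y => udx_pi A y) (Ud_mapE (sd_i A) x)). Qed.

Lemma xunit_q_sbar (x : xl_q A) : sbar A (udx_gen (x, 0)) = 0.
Proof. exact: (etrans (sbar_gen (x, 0)) (linear0 (ud_unit (xl_g A)))). Qed.

Definition xunit_q_fun (x : xl_q A) : ker_dias (sbar A) :=
  mkker (xunit_q_sbar x).

Lemma xunit_q_linear : linear xunit_q_fun.
Proof.
move=> a u v; apply: ker_inj.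
apply: etrans _ (esym (kval_linear a (xunit_q_fun u) (xunit_q_fun v))).
apply: etrans _ (linearP udx_gen a (u, 0) (v, 0)).
by congr (udx_gen _); congr pair; rewrite /= scaler0 addr0.
Qed.

Lemma udx_gen_br (u v : sdp A) : udx_gen (lbr u v) =
  udx_gen u ⊣ udx_gen v - udx_gen v ⊢ udx_gen u.
Proof. exact: lbh_br. Qed.

Lemma kvalB (x y : ker_dias (sbar A)) : kval (x - y) = kval x - kval y.
Proof. exact: (linearB (ker_incl (sbar A))). Qed.

(** With the next two lemmas, reduces the compatibility of the unit with the bracket of q and with
    both actions to [udx_gen] being a homomorphism. *)
Lemma sdp_br_qq (x y : xl_q A) :
  lbr ((x, 0) : sdp A) ((y, 0) : sdp A) = (lbr x y, 0).
Proof.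
congr pair => /=; last exact: bilin0l (lbr_bilin _) _.
by rewrite (bilin0r (bract_bilin _)) (bilin0l (blact_bilin _)) !addr0.
Qed.
Lemma sdp_br_gq (x : xl_g A) (y : xl_q A) :
  lbr ((0, x) : sdp A) ((y, 0) : sdp A) = (blact (xl_act A) x y, 0).
Proof.
congr pair => /=; last exact: bilin0r (lbr_bilin _) _.
by rewrite (bilin0l (lbr_bilin _)) (bilin0r (bract_bilin _)) !add0r.
Qed.
Lemma sdp_br_qg (x : xl_q A) (y : xl_g A) :
  lbr ((x, 0) : sdp A) ((0, y) : sdp A) = (bract (xl_act A) x y, 0).
Proof.
congr pair => /=; last exact: bilin0l (lbr_bilin _) _.
by rewrite (bilin0r (lbr_bilin _)) (bilin0l (blact_bilin _)) add0r addr0.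
Qed.

Lemma xunit_q_br x y :
  xunit_q_fun (lbr x y) = lbr (xunit_q_fun x : Lb _) (xunit_q_fun y).
Proof.
apply: ker_inj; apply: etrans _ (esym (kvalB _ _)).
by apply: etrans _ (udx_gen_br (x, 0) (y, 0)); rewrite sdp_br_qq.
Qed.

Definition xunit_q : lb_hom (xl_q A) (Lb (ker_dias (sbar A))) :=
  @LbHom k (xl_q A) (Lb (ker_dias (sbar A))) (mklin xunit_q_linear) xunit_q_br.

Definition xunit : xlb_hom A (XLb_obj (XUd_obj A)).
Proof.
exists (xunit_q : lb_hom (xl_q A) (xl_q (XLb_obj (XUd_obj A))))
       (ud_unit (xl_g A) : lb_hom (xl_g A) (xl_g (XLb_obj (XUd_obj A)))).
- by move=> x; apply: etrans (tbar_gen (x, 0)) _; rewrite /= addr0.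
- move=> x y; apply: ker_inj; apply: etrans _ (esym (kvalB _ _)).
  (* [Ud g] acts through [ibar], which takes the generator of x to that of (0, x). *)
  apply: etrans _ (congr2 (fun a b => a ⊣ _ - _ ⊢ b)
    (esym (ibar_gen x)) (esym (ibar_gen x))).
  by apply: etrans _ (udx_gen_br (0, x) (y, 0)); rewrite sdp_br_gq.
- move=> y x; apply: ker_inj; apply: etrans _ (esym (kvalB _ _)).
  apply: etrans _ (congr2 (fun a b => _ ⊣ a - b ⊢ _)
    (esym (ibar_gen x)) (esym (ibar_gen x))).
  by apply: etrans _ (udx_gen_br (y, 0) (0, x)); rewrite sdp_br_qg.
Defined.

End Unit.

Lemma xunit_natural (k : comPzRingType) (A B : xlb k) (f : xlb_hom A B) :
  xlb_comp (XLb_map (XUd_map f)) (xunit A) = xlb_comp (xunit B) f.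
Proof.
apply: xlb_hom_ext => x; last exact: Ud_mapE.
apply: ker_inj; apply: etrans (udx_mapE f _) _.
apply: (congr1 (udx_pi B)); apply: etrans (Ud_mapE _ _) _.
by congr (ud_unit _ _); congr pair; exact: linear0.
Qed.

Section Universal.
Variables (k : comPzRingType) (A : xlb k) (B : xdias k).

(** * Existence of the adjoint morphism *)

Section Lift.
Variable f : xlb_hom A (XLb_obj B).

Definition ud_dsd : dias_hom (Ud (sdp A)) (dsdp B) :=
  ud_lift (lb_comp (Lb_dsd B) (sd_map f)).

Definition ud_lift_g : dias_hom (Ud (xl_g A)) (xd_D B) :=
  ud_lift (xlh_g f : lb_hom (xl_g A) (Lb (xd_D B))).

Lemma ud_dsd_gen u :
  ud_dsd (ud_unit _ u) = (xlh_q f u.1, xlh_g f u.2) :> xd_L B * xd_D B.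
Proof. exact: (ud_liftE (lb_comp (Lb_dsd B) (sd_map f)) u). Qed.

Lemma dsd_snd_ud x : dsd_snd _ (ud_dsd x) = ud_lift_g (ud_s A x).
Proof.
have E : dias_comp (dsd_snd _) ud_dsd = dias_comp ud_lift_g (ud_s A).
  apply: ud_hom_ext => u; apply: etrans (congr1 snd (ud_dsd_gen u)) _.
  apply: esym; apply: etrans (congr1 ud_lift_g (Ud_mapE _ _)) _.
  exact: ud_liftE.
exact: (congr1 (fun h : dias_hom _ _ => h x) E).
Qed.

Lemma dsd_t_ud x : dsd_t B (ud_dsd x) = ud_lift_g (ud_t A x).
Proof.
have E : dias_comp (dsd_t B) ud_dsd = dias_comp ud_lift_g (ud_t A).
  apply: ud_hom_ext => u; apply: etrans (congr1 (dsd_t B) (ud_dsd_gen u)) _.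
  apply: esym; apply: etrans (congr1 ud_lift_g (Ud_mapE _ _)) _.
  apply: etrans (ud_liftE _ _) _; apply: etrans (linearD (xlh_g f) _ _) _.
  (* The first summands agree because f commutes with the structure maps nu and mu. *)
  by congr (_ + _); exact/esym/xlh_nu.
exact: (congr1 (fun h : dias_hom _ _ => h x) E).
Qed.

(** [ud_dsd] carries the kernels of [ud_s] and [ud_t] into those of [dsd_snd] and [dsd_t], whose
    products vanish by [dsd_annihil]. *)
Lemma udx_dsd_subproof : xset (ud_s A) (ud_t A) `<=` dker ud_dsd.
Proof.
apply: xset_sub => x y sx ty.
have {}sx : dsd_snd _ (ud_dsd x) = 0.
  exact: etrans (dsd_snd_ud x) (etrans (congr1 ud_lift_g sx) (linear0 _)).
have {}ty : dsd_t B (ud_dsd y) = 0.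
  exact: etrans (dsd_t_ud y) (etrans (congr1 ud_lift_g ty) (linear0 _)).
by rewrite !dhom_l !dhom_r; exact: dsd_annihil.
Qed.

Definition udx_dsd : dias_hom (UdX A) (dsdp B) :=
  quot_lift (xset_ideal _ _) udx_dsd_subproof.

Lemma udx_dsdE x : udx_dsd (udx_pi A x) = ud_dsd x.
Proof. exact: (quot_liftE (xset_ideal _ _) udx_dsd_subproof). Qed.

Lemma udx_dsd_snd x : (udx_dsd x).2 = ud_lift_g (sbar A x).
Proof.
elim/quot_pi_ind: x => x; apply: etrans (congr1 snd (udx_dsdE x)) _.
exact: etrans (dsd_snd_ud x) (congr1 ud_lift_g (esym (sbarE x))).
Qed.

Lemma udx_dsd_t x : dsd_t B (udx_dsd x) = ud_lift_g (tbar A x).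
Proof.
elim/quot_pi_ind: x => x; apply: etrans (congr1 (dsd_t B) (udx_dsdE x)) _.
exact: etrans (dsd_t_ud x) (congr1 ud_lift_g (esym (tbarE x))).
Qed.

Lemma udx_dsd_ibar x : udx_dsd (ibar A x) = (0, ud_lift_g x) :> xd_L B * xd_D B.
Proof.
have E : dias_comp udx_dsd (ibar A) = dias_comp (dsd_inr (xd_act B)) ud_lift_g.
  apply: ud_hom_ext => y; apply: etrans (congr1 udx_dsd (ibar_gen y)) _.
  apply: etrans (udx_dsdE _) _; apply: etrans (ud_dsd_gen _) _.
  apply: (congr2 pair); first exact: (linear0 (xlh_q f)).
  exact/esym/(ud_liftE (xlh_g f : lb_hom _ (Lb (xd_D B)))).
exact: (congr1 (fun h : dias_hom _ _ => h x) E).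
Qed.

Lemma udx_dsd_ker (l : ker_dias (sbar A)) :
  udx_dsd (kval l) = ((udx_dsd (kval l)).1, 0) :> xd_L B * xd_D B.
Proof.
rewrite [LHS]surjective_pairing; congr pair.
apply: etrans (udx_dsd_snd _) _.
exact: etrans (congr1 ud_lift_g (kval_eq0 l)) (linear0 _).
Qed.
Definition xlift_L_fun (l : ker_dias (sbar A)) : xd_L B := (udx_dsd (kval l)).1.

Lemma xlift_L_linear : linear xlift_L_fun.
Proof.
move=> a u v; apply: etrans (congr1 (fun y => (udx_dsd y).1) (kval_linear a u v)) _.
exact: (congr1 fst (linearP udx_dsd a (kval u) (kval v))).
Qed.

Definition xlift_L : dias_hom (ker_dias (sbar A)) (xd_L B).
Proof.
exists (mklin xlift_L_linear) => x y.
  apply: etrans (congr1 fst (dhom_l udx_dsd (kval x) (kval y))) _.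
  apply: etrans (congr1 fst
    (congr2 (dsd_l (xd_act B)) (udx_dsd_ker x) (udx_dsd_ker y))) _.
  by rewrite /= (bilin0r (lprod_bilin _)) (bilin0l (lprod_bilin _)) !addr0.
apply: etrans (congr1 fst (dhom_r udx_dsd (kval x) (kval y))) _.
apply: etrans (congr1 fst
  (congr2 (dsd_r (xd_act B)) (udx_dsd_ker x) (udx_dsd_ker y))) _.
by rewrite /= (bilin0r (rprod_bilin _)) (bilin0l (rprod_bilin _)) !addr0.
Defined.

Definition xlift : xdias_hom (XUd_obj A) B.
Proof.
exists (xlift_L : dias_hom (xd_L (XUd_obj A)) (xd_L B))
       (ud_lift_g : dias_hom (xd_D (XUd_obj A)) (xd_D B)).
- move=> l; apply: etrans _ (udx_dsd_t (kval l)).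
  (* On a pair (m, 0), [dsd_t] is just mu. *)
  apply: etrans _ (congr1 (@dsd_t_fun k B) (esym (udx_dsd_ker l))).
  by rewrite /dsd_t_fun addr0.
- move=> x l; split.
    (* The action becomes a product of (0, d) and (m, 0), whose first component retains only the
       action of d on m. *)
    apply: etrans (congr1 fst (dhom_l udx_dsd (ibar A x) (kval l))) _.
    apply: etrans (congr1 fst
      (congr2 (dsd_l (xd_act B)) (udx_dsd_ibar x) (udx_dsd_ker l))) _.
    by rewrite /= (bilin0l (lprod_bilin _)) (bilin0l (lprod_bilin _)) !add0r.
  apply: etrans (congr1 fst (dhom_r udx_dsd (ibar A x) (kval l))) _.
  apply: etrans (congr1 fst
    (congr2 (dsd_r (xd_act B)) (udx_dsd_ibar x) (udx_dsd_ker l))) _.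
  by rewrite /= (bilin0l (rprod_bilin _)) (bilin0l (rprod_bilin _)) !add0r.
- move=> l x; split.
    apply: etrans (congr1 fst (dhom_l udx_dsd (kval l) (ibar A x))) _.
    apply: etrans (congr1 fst
      (congr2 (dsd_l (xd_act B)) (udx_dsd_ker l) (udx_dsd_ibar x))) _.
    by rewrite /= (bilin0r (lprod_bilin _)) (bilin0r (lprod_bilin _)) addr0 add0r.
  apply: etrans (congr1 fst (dhom_r udx_dsd (kval l) (ibar A x))) _.
  apply: etrans (congr1 fst
    (congr2 (dsd_r (xd_act B)) (udx_dsd_ker l) (udx_dsd_ibar x))) _.
  by rewrite /= (bilin0r (rprod_bilin _)) (bilin0r (rprod_bilin _)) addr0 add0r.
Defined.

Lemma xlift_xunit : xlb_comp (XLb_map xlift) (xunit A) = f.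
Proof.
apply: xlb_hom_ext => x; last first.
  exact: (ud_liftE (xlh_g f : lb_hom (xl_g A) (Lb (xd_D B)))).
by apply: etrans (congr1 fst (udx_dsdE _)) _; exact: (congr1 fst (ud_dsd_gen _)).
Qed.

End Lift.

(** * Uniqueness of the adjoint morphism *)

Section Uniqueness.
Variable h : xdias_hom (XUd_obj A) B.

Lemma sbar_proj x : sbar A (x - ibar A (sbar A x)) = 0.
Proof. by rewrite linearB sibar subrr. Qed.

(* h extends along UdX A = ker sbar + Ud g to a map into the semidirect
   product, so that it can be tested on the generators of Ud (sdp A). *)
Definition xext_fun (x : UdX A) : dsdp B :=
  (xdh_L h (mkker (sbar_proj x)), xdh_D h (sbar A x)).

Lemma xext_linear : linear xext_fun.
Proof.
move=> a u v; apply: (congr2 pair); last first.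
  exact: etrans (congr1 (xdh_D h) (linearP (sbar A) a u v))
    (linearP (xdh_D h) a _ _).
apply: etrans _ (linearP (xdh_L h) a (mkker (sbar_proj u)) (mkker (sbar_proj v))).
congr (xdh_L h _); apply: ker_inj; apply: etrans _ (esym (kval_linear a _ _)).
change (a *: u + v - ibar A (sbar A (a *: u + v)) =
  a *: (u - ibar A (sbar A u)) + (v - ibar A (sbar A v))).
rewrite (linearP (sbar A) a u v) (linearP (ibar A) a (sbar A u) (sbar A v)).
by rewrite scalerBr opprD addrACA.
Qed.

Definition xext : dias_hom (UdX A) (dsdp B).
Proof.
exists (mklin xext_linear) => u v; apply: (congr2 pair).
- set m := mkker (sbar_proj u); set n := mkker (sbar_proj v).
  (* Expanding the product of u = m + [ibar (sbar u)] and v = n + [ibar (sbar v)] leaves three terms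
     in the kernel; h sends them to the three terms of the product in the target. *)
  have e : mkker (sbar_proj (u ⊣ v)) = (m ⊣[ker_prod (sbar A)] n
      + m ⊣[ker_ract (sbar A) (ibar A)] sbar A v
      + sbar A u ⊣[ker_lact (sbar A) (ibar A)] n :> ker_dias (sbar A)).
    apply: ker_inj; apply: etrans _ (esym (linearD (ker_incl (sbar A)) _ _)).
    apply: etrans _ (congr1 (fun y => y + _)
      (esym (linearD (ker_incl (sbar A)) _ _))).
    apply: etrans _ (esym (bilin_sub_split (lprod_bilin (dprod (UdX A)))
      u (ibar A (sbar A u)) v (ibar A (sbar A v)))).
    apply: (congr1 (fun y => u ⊣ v - y)).
    exact: etrans (congr1 (ibar A) (dhom_l (sbar A) u v)) (dhom_l (ibar A) _ _).
  apply: etrans (congr1 (xdh_L h) e) _.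
  apply: etrans (linearD (xdh_L h) _ _) _.
  apply: (congr2 +%R); last exact: (xdh_lact h (sbar A u) n).1.
  apply: etrans (linearD (xdh_L h) _ _) _.
  apply: (congr2 +%R); last exact: (xdh_ract h m (sbar A v)).1.
  exact: (dhom_l (xdh_L h)).
- exact: etrans (congr1 (xdh_D h) (dhom_l (sbar A) u v)) (dhom_l (xdh_D h) _ _).
- set m := mkker (sbar_proj u); set n := mkker (sbar_proj v).
  have e : mkker (sbar_proj (u ⊢ v)) = (m ⊢[ker_prod (sbar A)] n
      + m ⊢[ker_ract (sbar A) (ibar A)] sbar A v
      + sbar A u ⊢[ker_lact (sbar A) (ibar A)] n :> ker_dias (sbar A)).
    apply: ker_inj; apply: etrans _ (esym (linearD (ker_incl (sbar A)) _ _)).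
    apply: etrans _ (congr1 (fun y => y + _)
      (esym (linearD (ker_incl (sbar A)) _ _))).
    apply: etrans _ (esym (bilin_sub_split (rprod_bilin (dprod (UdX A)))
      u (ibar A (sbar A u)) v (ibar A (sbar A v)))).
    apply: (congr1 (fun y => u ⊢ v - y)).
    exact: etrans (congr1 (ibar A) (dhom_r (sbar A) u v)) (dhom_r (ibar A) _ _).
  apply: etrans (congr1 (xdh_L h) e) _.
  apply: etrans (linearD (xdh_L h) _ _) _.
  apply: (congr2 +%R); last exact: (xdh_lact h (sbar A u) n).2.
  apply: etrans (linearD (xdh_L h) _ _) _.
  apply: (congr2 +%R); last exact: (xdh_ract h m (sbar A v)).2.
  exact: (dhom_r (xdh_L h)).
- exact: etrans (congr1 (xdh_D h) (dhom_r (sbar A) u v)) (dhom_r (xdh_D h) _ _).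
Defined.

(** Projecting the generator of (a, b) to the kernel subtracts that of (0, b) and leaves that of (a,
    0). Thus on generators [xext h] depends only on h composed with the unit. *)
Lemma xext_gen u : xext (udx_gen A u) =
  (xdh_L h (xunit_q A u.1), xdh_D h (ud_unit (xl_g A) u.2)) :> xd_L B * xd_D B.
Proof.
apply: (congr2 pair); last exact: (congr1 (xdh_D h) (sbar_gen u)).
congr (xdh_L h _); apply: ker_inj.
have e : ibar A (sbar A (udx_gen A u)) = udx_gen A (0, u.2).
  exact: etrans (congr1 (ibar A) (sbar_gen u)) (ibar_gen _).
apply: etrans (congr1 (fun y => udx_gen A u - y) e) _.
apply: etrans (esym (linearB (udx_gen A) u (0, u.2))) _.
by congr (udx_gen A _); congr pair; rewrite /= ?subr0 ?subrr.
Qed.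

(** The projection fixes the kernel, so h can be recovered from its extension. *)
Lemma xext_ker (l : ker_dias (sbar A)) : (xext (kval l)).1 = xdh_L h l.
Proof.
apply: (congr1 (xdh_L h)); apply: ker_inj.
apply: etrans (congr1 (fun y => kval l - ibar A y) (kval_eq0 l)) _.
by rewrite linear0 subr0.
Qed.

End Uniqueness.

(** The unit controls values at generators of [UdX A] only, so the maps on the kernel are compared
    through their extensions. *)
Lemma xud_hom_ext (h h' : xdias_hom (XUd_obj A) B) :
  xlb_comp (XLb_map h) (xunit A) = xlb_comp (XLb_map h') (xunit A) -> h = h'.
Proof.
move=> e.
have eD : xdh_D h = xdh_D h'.
  by apply: ud_hom_ext => x; exact: (congr1 (fun f => xlh_g f x) e).
have eX : xext h = xext h'.
  apply: quot_hom_ext => x.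
  suff E : dias_comp (xext h) (udx_pi A) = dias_comp (xext h') (udx_pi A).
    exact: (congr1 (fun f : dias_hom _ _ => f x) E).
  apply: ud_hom_ext => u; apply: etrans (xext_gen h u) _.
  apply: etrans _ (esym (xext_gen h' u)); apply: (congr2 pair).
    exact: (congr1 (fun f => xlh_q f u.1) e).
  exact: (congr1 (fun f => xlh_g f u.2) e).
apply: xdias_hom_ext => [l|x]; last by rewrite eD.
apply: etrans (esym (xext_ker h l)) _; apply: etrans _ (xext_ker h' l).
by rewrite eX.
Qed.

End Universal.

(** * The adjunction *)

Theorem theorem5p5 (k : comPzRingType) :
  left_adjoint (XUd_functor k) (XLb_functor k).
Proof.
exists (fun A B (h : xdias_hom (XUd_obj A) B) =>
  xlb_comp (XLb_map h) (xunit A)); split=> [A B|A A' B B' f g h].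
  exists (@xlift k A B); last exact: xlift_xunit.
  by move=> h; apply: xud_hom_ext; exact: xlift_xunit.
(* Composing with g and h on the left is the same on both sides, so naturality reduces to that of
   the unit along f. *)
have e := xunit_natural (f : xlb_hom A' A).
apply: xlb_hom_ext => x.
  have eq_q : xud_ker f (xunit_q A' x) = xunit_q A (xlh_q f x).
    exact: (congr1 (fun u => xlh_q u x) e).
  exact: (congr1 (fun y => xdh_L g (xdh_L h y)) eq_q).
have eq_g : Ud_map (xlh_g f) (ud_unit (xl_g A') x) = ud_unit (xl_g A) (xlh_g f x).
  exact: Ud_mapE.
exact: (congr1 (fun y => xdh_D g (xdh_D h y)) eq_g).
Qed.
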